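(* Let $\delta\ge3$ be finite, let $C_0>2\delta+3$ be even with $C_0\le 3\delta+2$, and let $\mathcal S$ be an admissible set of Henson constraints for $\mathcal A^\delta_{\infty,0,C_0,2\delta+1}$. Then the class of convex orderings of members of $\mathcal A^\delta_{\infty,0,C_0,2\delta+1}\cap\mathcal A_{\mathcal S}$, expanded by an additional unary predicate determining the bipartition, is Ramsey and has the expansion property.
   Context: $\mathcal A^\delta_{\infty,0,C_0,2\delta+1}$ is the class of finite metric spaces with integer distances in $\{1,\dots,\delta\}$ containing no triangle of odd perimeter and no triangle of even perimeter $\ge C_0$. In such a space, ''$d(u,v)$ is even'' is an equivalence relation with at most two classes (the bipartition); a unary predicate determining the bipartition is a predicate $P$ such that $d(u,v)$ is even iff $u,v$ are both in $P$ or both outside $P$. A convex ordering is a linear order in which the vertices in $P$ form an initial segment. A Henson constraint is a metric space all of whose distances are $1$ or $\delta$; $\mathcal A_{\mathcal S}$ is the class of finite metric spaces into which no member of $\mathcal S$ embeds; $\mathcal S$ is admissible here if it is a set of Henson constraints each with at least 4 points and containing no triangle forbidden in $\mathcal A^\delta_{\infty,0,C_0,2\delta+1}$. A class $\mathcal C$ is Ramsey if for all $\mathbf A,\mathbf B\in\mathcal C$ and $k\ge1$ there is $\mathbf C\in\mathcal C$ such that for every $k$-colouring of the copies of $\mathbf A$ in $\mathbf C$ some copy of $\mathbf B$ in $\mathbf C$ has all its copies of $\mathbf A$ of one colour. A class $\mathcal K^+$ of expansions of $\mathcal K$ has the expansion property if for every $\mathbf A\in\mathcal K$ there is $\mathbf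 B\in\mathcal K$ such that every expansion of $\mathbf A$ in $\mathcal K^+$ embeds into every expansion of $\mathbf B$ in $\mathcal K^+$. *)

(* Defs.v *)
From mathcomp Require Import all_boot.
Set Implicit Arguments.
Unset Strict Implicit.
Unset Printing Implicit Defensive.

Record metric (T : Type) := Metric {
  dist :> T -> T -> nat;
  dist_eq0 : forall x y, dist x y = 0 <-> x = y;
  dist_sym : forall x y, dist x y = dist y x;
  dist_triangle : forall x y z, dist x z <= dist x y + dist y z
}.

(* The carrier is an arbitrary type because Henson constraints are not required
   to be finite. *)
Record metric_space := MetricSpace {
  point :> Type;
  space_metric : metric point
}.

Record fin_metric_space := FinMetricSpace {
  fin_point :> finType;
  fin_space_metric : metric fin_point
}.

Coercion metric_space_of_fin (A : fin_metric_space) : metric_space :=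
  MetricSpace (fin_space_metric A).

Definition distance (M : metric_space) : M -> M -> nat := space_metric M.

(* Distance-preserving maps are injective by [dist_eq0]. *)
Definition isometric (M N : metric_space) (f : M -> N) : Prop :=
  forall x y : M, distance (f x) (f y) = distance x y.

Definition embeds (M N : metric_space) : Prop :=
  exists f : M -> N, isometric f.

Definition forbidden_perimeter (C0 p : nat) : Prop :=
  odd p \/ (~~ odd p /\ C0 <= p).

Definition no_forbidden_triangle (C0 : nat) (M : metric_space) : Prop :=
  forall x y z : M, x <> y -> y <> z -> x <> z ->
  ~ forbidden_perimeter C0 (distance x y + distance y z + distance x z).

(* The class A^delta_{oo,0,C0,2delta+1}. *)
Definition bipartite_class (delta C0 : nat) (A : fin_metric_space) : Prop :=
  (forall x y : metric_space_of_fin A, x <> y -> 1 <= distance x y <= delta) /\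
  no_forbidden_triangle C0 A.

Definition henson_constraint (delta : nat) (M : metric_space) : Prop :=
  forall x y : M, x <> y -> distance x y = 1 \/ distance x y = delta.

Definition at_least_points (n : nat) (M : metric_space) : Prop :=
  exists f : 'I_n -> M, injective f.

Definition admissible (delta C0 : nat) (S : metric_space -> Prop) : Prop :=
  forall M : metric_space, S M ->
  [/\ henson_constraint delta M, at_least_points 4 M
    & no_forbidden_triangle C0 M].

Definition omits (S : metric_space -> Prop) (A : fin_metric_space) : Prop :=
  forall M : metric_space, S M -> ~ embeds M A.

(* An expansion of the metric structure [A] by a binary relation (non-strict
   order) and a unary predicate. *)
Record expansion (A : fin_metric_space) := Expansion {
  ord_le : rel A;
  in_part : pred A
}.

Definition linear_order (T : Type) (le : rel T) : Prop :=
  [/\ reflexive le, antisymmetric le, transitive le & total le].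

Definition determines_bipartition (A : fin_metric_space) (P : pred A) : Prop :=
  forall u v : metric_space_of_fin A, ~~ odd (distance u v) <-> P u = P v.

Definition convex_order (T : Type) (le : rel T) (P : pred T) : Prop :=
  linear_order le /\ (forall u v : T, le u v -> P v -> P u).

Definition convex_expansions (K : fin_metric_space -> Prop)
    (A : fin_metric_space) (a : expansion A) : Prop :=
  [/\ K A, determines_bipartition (in_part a)
    & convex_order (ord_le a) (in_part a)].

Definition exp_embedding (A B : fin_metric_space)
    (a : expansion A) (b : expansion B) (f : A -> B) : Prop :=
  [/\ @isometric A B f,
      forall x y : A, ord_le b (f x) (f y) = ord_le a x y
    & forall x : A, in_part b (f x) = in_part a x].

(* Copies of [A] are substructures isomorphic to [A]; a substructure of a
   relational structure is identified with its vertex set. *)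
Definition copy (A C : fin_metric_space)
    (a : expansion A) (c : expansion C) (X : {set C}) : Prop :=
  exists2 f : A -> C, exp_embedding a c f & X = f @: [set: A].

Definition ramsey (Kp : forall A : fin_metric_space, expansion A -> Prop) :
    Prop :=
  forall (A B : fin_metric_space) (a : expansion A) (b : expansion B) (k : nat),
  Kp A a -> Kp B b -> 1 <= k ->
  exists (C : fin_metric_space) (c : expansion C), Kp C c /\
    forall col : {set C} -> 'I_k,
    exists2 Y : {set C}, copy b c Y &
    exists i : 'I_k, forall X : {set C}, copy a c X -> X \subset Y -> col X = i.

Definition expansion_property (K : fin_metric_space -> Prop)
    (Kp : forall A : fin_metric_space, expansion A -> Prop) : Prop :=
  forall A : fin_metric_space, K A ->
  exists2 B : fin_metric_space, K B &
  forall (a : expansion A) (b : expansion B), Kp A a -> Kp B b ->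
  exists f : A -> B, exp_embedding a b f.

(* Main.v *)
Require Import Defs.
From mathcomp Require Import all_boot.
From mathcomp Require Import boolp zify.
Set Implicit Arguments.
Unset Strict Implicit.
Unset Printing Implicit Defensive.

(** Put [H = (C0 - 2) / 2].  Replacing the length [l] of a step by [H - l] is
    called flipping it; a labelled graph extends to a space of the class as soon
    as every closed walk with an odd number of flipped steps has total length at
    least [H] (and labels have the right parity).  Indeed the shortest walks with
    an even, resp. odd, number of flips bound the missing distances from above,
    resp. below, and a missing distance is taken as close as these bounds allow
    to [delta / 2] or [delta / 2 + 1], according to parity.  Walks of more than
    [H] steps are harmless, so only boundedly short closed walks matter.

    The Ramsey property comes from iterating the partite construction of
    Nesetril and Rodl, based on the Hales-Jewett theorem and started from
    Ramsey's theorem: each round makes closed walks with one more step good,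
    because a closed walk visiting two copies of the previous picture is cut, by
    an edge of a copy of [A], into two shorter closed walks of the previous
    round.  From the second round on, cliques come from [B], so that the Henson
    constraints stay omitted.

    For the expansion property, Ramsey for two-point spaces makes a second
    convex order agree with, or reverse, the first one uniformly on pairs at a
    given distance in a given part, and triangles with sides [l, l, 2] make this
    choice independent of the distance [l]. *)

(** * The Hales-Jewett and Ramsey theorems *)

(** A combinatorial line is a word over [option A], with [None] marking the moving coordinates. *)
Definition line_point (I A : finType) (l : {ffun I -> option A}) (x : A) :
  {ffun I -> A} := [ffun i => odflt x (l i)].

Definition hales_jewett_for (A : finType) :=
  forall K : finType, exists I : finType, forall C : {ffun I -> A} -> K,
  exists2 l : {ffun I -> option A}, exists i, l i = None &
  forall x y, C (line_point l x) = C (line_point l y).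

Lemma hales_jewett_surj (A A' : finType) (f : A -> A') (g : A' -> A) :
  cancel g f -> hales_jewett_for A -> hales_jewett_for A'.
Proof.
move=> gK HA K; have [I HI] := HA K; exists I => C.
have [l [i li] lC] := HI (fun w => C [ffun i => f (w i)]).
exists [ffun i => omap f (l i)]; first by exists i; rewrite ffunE li.
have E x : line_point [ffun i => omap f (l i)] x
           = [ffun i => f (line_point l (g x) i)].
  by apply/ffunP => j; rewrite !ffunE; case: (l j) => //=; rewrite gK.
by move=> x y; rewrite !E.
Qed.

Section HalesJewettOption.
Variables (A K : finType) (x0 : A).

(** Colour focusing: apart from their common end at the new letter [None], the lines are
    monochromatic, in pairwise distinct colours. *)
Definition focused_lines (I : finType) (C : {ffun I -> option A} -> K)
    (L : seq {ffun I -> option (option A)}) (foc : {ffun I -> option A}) :=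
  [/\ forall l, l \in L -> exists i, l i = None,
      forall l, l \in L -> line_point l None = foc,
      forall l x, l \in L ->
        C (line_point l (Some x)) = C (line_point l (Some x0))
    & uniq [seq C (line_point l (Some x0)) | l : {ffun I -> option (option A)} <- L]].

Definition pair_fun (I J : finType) (V : Type) (w : {ffun I -> V})
    (v : {ffun J -> V}) : {ffun (I + J)%type -> V} :=
  [ffun s => match s with inl i => w i | inr j => v j end].

(** Induction on [r]. If the focus repeats the colour of one of the lines, that line is
    monochromatic up to its end; otherwise a new block [J] of coordinates turns [r] focused lines
    into [r + 1]. *)
Lemma focused_or_mono : hales_jewett_for A -> forall r, exists I : finType,
  forall C : {ffun I -> option A} -> K,
  (exists2 l : {ffun I -> option (option A)}, exists i, l i = None &
     forall x y, C (line_point l x) = C (line_point l y)) \/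
  (exists L foc, size L = r /\ focused_lines C L foc).
Proof.
move=> HA; elim=> [|r [I HI]].
  by exists unit => C; right; exists [::], [ffun=> None].
(* A colour here is a whole colouring of the words on [I]. Along the line found, at letters from
   [A], the colour then depends on the [I]-part only. *)
have [J HJ] := HA {ffun {ffun I -> option A} -> K}.
exists (I + J)%type => C.
have [l' [j lj] l'C] :=
  HJ (fun v : {ffun J -> A} => [ffun w => C (pair_fun w [ffun j => Some (v j)])]).
pose v0 := [ffun j => Some (line_point l' x0 j)].
have vC w x : C (pair_fun w [ffun j => Some (line_point l' x j)])
              = C (pair_fun w v0).
  by have /ffunP/(_ w) := l'C x x0; rewrite !ffunE.
have horiz (l : {ffun I -> option (option A)}) : (exists i, l i = None) ->
    (forall x y, C (pair_fun (line_point l x) v0)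
                 = C (pair_fun (line_point l y) v0)) ->
    exists2 l : {ffun (I + J)%type -> option (option A)}, exists i, l i = None &
     forall x y, C (line_point l x) = C (line_point l y).
  move=> [i li] lC; exists (pair_fun l [ffun j => Some (v0 j)]).
    by exists (inl i); rewrite ffunE.
  have E x : line_point (pair_fun l [ffun j => Some (v0 j)]) x
             = pair_fun (line_point l x) v0.
    by apply/ffunP => -[k|k]; rewrite !ffunE //= !ffunE.
  by move=> x y; rewrite !E.
pose D w := C (pair_fun w v0).
case: (HI D) => [[l lm lC]|[L [foc [sL [Lm Lf LC Lu]]]]].
  by left; apply: horiz lm lC.
have [/mapP[l lL fC]|nfoc] :=
  boolP (D foc \in [seq D (line_point l (Some x0))
                       | l : {ffun I -> option (option A)} <- L]).
  left; apply: (horiz l); first exact: Lm.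
  have E x : D (line_point l x) = D foc.
    case: x => [x|]; last by rewrite Lf.
    by rewrite LC.
  by move=> x y; apply: etrans (E x) (esym (E y)).
right.
(* The old lines move together with [l2]; the additional line fixes the old focus and moves along
   [l2] alone. *)
pose l2 : {ffun J -> option (option A)} := [ffun j => omap Some (l' j)].
pose foc2 := line_point l2 None.
pose vert : {ffun (I + J)%type -> option (option A)} :=
  pair_fun [ffun i => Some (foc i)] l2.
pose prodl (l : {ffun I -> option (option A)}) := pair_fun l l2.
have l2S x : line_point l2 (Some x) = [ffun j => Some (line_point l' x j)].
  by apply/ffunP => k; rewrite !ffunE; case: (l' k).
have prodE l x : line_point (prodl l) x = pair_fun (line_point l x) (line_point l2 x).
  by apply/ffunP => -[k|k]; rewrite !ffunE //= ?ffunE.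
have vertE x : line_point vert x = pair_fun foc (line_point l2 x).
  by apply/ffunP => -[k|k]; rewrite !ffunE //= ?ffunE.
have prodC l x : C (line_point (prodl l) (Some x)) = D (line_point l (Some x)).
  by rewrite prodE l2S vC.
have vertC x : C (line_point vert (Some x)) = D foc by rewrite vertE l2S vC.
exists (vert :: map prodl L), (pair_fun foc foc2); split; first by rewrite /= size_map sL.
split.
- move=> l; rewrite inE => /orP[/eqP->|/mapP[l1 /Lm[i li] ->]].
    by exists (inr j); rewrite !ffunE lj.
  by exists (inl i); rewrite ffunE.
- move=> l; rewrite inE => /orP[/eqP->|/mapP[l1 l1L ->]]; first by rewrite vertE.
  by rewrite prodE Lf.
- move=> l x; rewrite inE => /orP[/eqP->|/mapP[l1 l1L ->]]; first by rewrite !vertC.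
  by rewrite !prodC; apply: LC.
- rewrite /= vertC -map_comp (eq_map (g := fun l => D (line_point l (Some x0)))).
    by rewrite nfoc.
  by move=> l /=; rewrite prodC.
Qed.

End HalesJewettOption.

(** More focused lines than colours cannot exist, so some line is monochromatic. An empty [A] offers
    no [x0], but then [option A] has a single letter. *)
Lemma hales_jewett_option (A : finType) :
  hales_jewett_for A -> hales_jewett_for (option A).
Proof.
move=> HA K; case: (pickP (fun _ : A => true)) => [x0 _|A0]; last first.
  exists unit => C; exists [ffun=> None]; first by exists tt; rewrite ffunE.
  by case=> [x|] [y|] //; [have := A0 x | have := A0 x | have := A0 y].
have [I HI] := focused_or_mono K x0 HA #|K|.+1.
exists I => C; case: (HI C) => // -[L [foc [sL [_ _ _ Lu]]]].
by have := max_card (mem [seq C (line_point l (Some x0))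
                         | l : {ffun I -> option (option A)} <- L]);
  rewrite (card_uniqP Lu) size_map sL ltnn.
Qed.

Lemma hales_jewett (A : finType) : hales_jewett_for A.
Proof.
apply: (hales_jewett_surj (f := enum_val) (g := enum_rank)); first exact: enum_rankK.
elim: #|_| => [|n IHn].
  by move=> K; exists unit => C; exists [ffun=> None]; [exists tt; rewrite ffunE | case].
apply: (hales_jewett_surj (f := oapp (lift ord0) ord0) (g := unlift ord0)).
  by move=> x; case: unliftP => [j|] ->.
exact: hales_jewett_option.
Qed.

Section FiniteRamsey.
Variables (T : eqType) (K : finType) (k0 : K).

Lemma pigeonhole_seq (f : T -> K) (b : nat) (s : seq T) :
  #|K| * b <= size s -> exists i, b <= count (fun x => f x == i) s.
Proof.
move=> sz; apply: contrapT => /forallNP nb.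
have b0 : 0 < b by case: b nb {sz} => // /(_ k0).
have : size s = \sum_i count (fun x => f x == i) s.
  elim: s {sz nb} => [|x s IH] /=; first by rewrite big1.
  rewrite big_split /= -IH (bigD1 (f x)) //= eqxx big1 ?addn0 ?add1n // => i.
  by rewrite eq_sym => /negbTE->.
have : \sum_i count (fun x => f x == i) s <= \sum_(i : K) b.-1.
  by apply: leq_sum => i _; have := nb i; lia.
rewrite sum_nat_const => le1 eq1.
have K0 : 0 < #|K| by apply/card_gt0P; exists k0.
have : #|K| * b.-1 < #|K| * b by rewrite ltn_pmul2l //; lia.
by rewrite ltnNge (leq_trans sz) // eq1.
Qed.

(** Induction on the size [a]: thin out [s] until the colour depends on the first element only, then
    apply the pigeonhole principle. *)
Lemma ramsey_seq (a b : nat) : exists N, forall (s : seq T) (c : seq T -> K),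
  uniq s -> N <= size s -> exists t, [/\ subseq t s, size t = b &
  exists i, forall X, subseq X t -> size X = a -> c X = i].
Proof.
elim: a b => [|a IHa] b.
  exists b => s c us sz; exists (take b s); split; first exact: take_subseq.
    by rewrite size_takel.
  by exists (c [::]) => -[].
have [N endhom] : exists N, forall (s : seq T) (c : seq T -> K),
    uniq s -> N <= size s -> exists t, [/\ subseq t s, size t = #|K| * b &
    exists f, forall x X, subseq (x :: X) t -> size X = a -> c (x :: X) = f x].
  elim: (#|K| * b) => [|m [N IHm]].
    exists 0 => s c us sz; exists [::]; split; [exact: sub0seq | by [] | ].
    by exists (fun=> k0).
  have [N' HN'] := IHa N; exists N'.+1 => -[|y s] c //= /andP[ys us] sz.
  have [t [ts tN [i ti]]] := HN' s (fun X => c (y :: X)) us sz.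
  have [t' [t't t'm [f ft']]] :=
    IHm t c (subseq_uniq ts us) (eq_leq (esym tN)).
  have t's := subseq_trans t't ts.
  have yt' : y \notin t' by apply: contra ys; apply: mem_subseq.
  exists (y :: t'); split; [by rewrite /= eqxx | by rewrite /= t'm | ].
  exists (fun x => if x == y then i else f x) => x X /=.
  case: eqP => [-> Xt' sX|_ Xt' sX].
    by apply: ti => //; apply: subseq_trans t't.
  exact: ft'.
exists N => s c us sz; have [t [ts tm [f ft]]] := endhom s c us sz.
have [i] := pigeonhole_seq f (eq_leq (esym tm)).
rewrite -size_filter => bi.
exists (take b [seq x <- t | f x == i]); split.
- by apply: subseq_trans (take_subseq _ _) (subseq_trans (filter_subseq _ _) ts).
- by rewrite size_takel.
- exists i => -[|x X] // sX [aX].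
  have sX' := subseq_trans sX (take_subseq _ _).
  rewrite ft // ?(subseq_trans sX' (filter_subseq _ _)) //.
  have : x \in [seq x <- t | f x == i] by apply: (mem_subseq sX'); rewrite mem_head.
  by rewrite mem_filter => /andP[/eqP].
Qed.

End FiniteRamsey.

(** * Walks with flips *)

Section Walks.
Variable H : nat.

(** The indices are the end points, the number of steps, the parity of the number of flipped steps,
    and the total length. *)
Inductive walk (T : Type) (e : T -> T -> nat -> Prop) :
    T -> T -> nat -> bool -> nat -> Prop :=
| walk_nil x : walk e x x 0 false 0
| walk_cons x y z l b n c s : e x y l -> walk e y z n c s ->
    walk e x z n.+1 (b (+) c) ((if b then H - l else l) + s).

Definition good (T : Type) (e : T -> T -> nat -> Prop) (k : nat) :=
  forall x n s, n <= k -> walk e x x n true s -> H <= s.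

Definition single_valued (T : Type) (e : T -> T -> nat -> Prop) :=
  forall x y l l', e x y l -> e x y l' -> l = l'.

Lemma walk_cat (T : Type) (e : T -> T -> nat -> Prop) x y z n b s n' b' s' :
  walk e x y n b s -> walk e y z n' b' s' ->
  walk e x z (n + n') (b (+) b') (s + s').
Proof.
move=> w w'; elim: w w' => [//|u v w l c m c' t ev _ IH] /IH w'.
by rewrite -addbA -addnA addSn; apply: walk_cons w'.
Qed.

Lemma walk_edge (T : Type) (e : T -> T -> nat -> Prop) x y l b :
  e x y l -> walk e x y 1 b (if b then H - l else l).
Proof.
by move=> ex; have := walk_cons b ex (walk_nil e y); rewrite addbF addn0.
Qed.

Lemma walk1_edge (T : Type) (e : T -> T -> nat -> Prop) x y b s :
  walk e x y 1 b s -> exists2 l, e x y l & s = if b then H - l else l.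
Proof.
move=> w; inversion w as [|x' y' z' l c n c' t exy w'].
by inversion w'; subst; exists l; rewrite ?addbF ?addn0.
Qed.

Lemma walk_map (T U : Type) (e : T -> T -> nat -> Prop)
    (e' : U -> U -> nat -> Prop) (f : T -> U) x y n b s :
  (forall u v l, e u v l -> e' (f u) (f v) l) ->
  walk e x y n b s -> walk e' (f x) (f y) n b s.
Proof.
move=> fe; elim=> [u|u v w l c m c' t /fe ev _ IH]; first exact: walk_nil.
exact: walk_cons IH.
Qed.

Lemma walk_rev (T : Type) (e : T -> T -> nat -> Prop) x y n b s :
  (forall u v l, e u v l -> e v u l) -> walk e x y n b s -> walk e y x n b s.
Proof.
move=> esym; elim=> [u|u v w l c m c' t /esym ev _ IH]; first exact: walk_nil.
by rewrite addbC addnC -addn1; apply: walk_cat IH (walk_edge _ ev).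
Qed.

(** Flipping two sides of a triangle inequality gives another triangle inequality or the perimeter
    bound, so each step preserves the estimate. At [x = y] it bounds closed odd walks below by
    [H]. *)
Lemma walk_metric (T : Type) (d : T -> T -> nat) :
  (forall x, d x x = 0) -> (forall x y, d x y = d y x) ->
  (forall x y z, d x z <= d x y + d y z) ->
  (forall x y z, d x y + d y z + d x z <= H.*2) ->
  forall x y n b s, walk (fun x y l => l = d x y) x y n b s ->
  (if b then H - d x y else d x y) <= s.
Proof.
move=> d0 dsym tri per x y n b s; elim=> [u|u v w l c m c' t -> _]; first by rewrite d0.
have := tri u v w; have := tri u w v; have := tri v u w.
(* Degenerate triples give [d <= H], so no subtraction is truncated. *)
have := per u v w; have := per u v v; have := per v w w; have := per u w w.
rewrite !d0 (dsym w v) (dsym v u).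
by case: c; case: c' => /=; lia.
Qed.

Lemma good0 (T : Type) (e : T -> T -> nat -> Prop) : good e 0.
Proof. by move=> x [|n] // s _ w; inversion w. Qed.

End Walks.

(** * The partite construction *)

Section Systems.
Variables (H : nat) (A B : finType) (dA : A -> A -> nat) (dB : B -> B -> nat).
Hypothesis dA_sym : forall r s, dA r s = dA s r.
Hypothesis dA_le : forall r s, dA r s <= H.
Hypothesis dB0 : forall x, dB x x = 0.
Hypothesis dB_sym : forall x y, dB x y = dB y x.
Hypothesis dB_tri : forall x y z, dB x z <= dB x y + dB y z.
Hypothesis dB_per : forall x y z, dB x y + dB y z + dB x z <= H.*2.
Variable G : {set {ffun A -> B}}.
Hypothesis G_inj : forall g, g \in G -> injective g.
Hypothesis G_iso : forall (g : {ffun A -> B}) r s, g \in G ->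
  dB (g r) (g s) = dA r s.
Variables (K : finType) (k0 : K).

Definition fcomp (X Y Z : finType) (f : Y -> Z) (b : {ffun X -> Y}) :
  {ffun X -> Z} := [ffun x => f (b x)].

Lemma fcompA (X Y Z W : finType) (h : Z -> W) (f : Y -> Z) (b : {ffun X -> Y}) :
  fcomp h (fcomp f b) = fcomp (h \o f) b.
Proof. by apply/ffunP => x; rewrite !ffunE. Qed.

(* A system on [T] is a family of copies of [B] in [T]; its labelled edges are
   the images of the pairs of points of [B]. *)
Definition edge (T : finType) (F : {set {ffun B -> T}}) (x y : T) (l : nat) :=
  exists b u v, [/\ b \in F, u <> v, x = b u, y = b v & l = dB u v].

Definition ramsey_system (T : finType) (F : {set {ffun B -> T}}) :=
  forall chi : {ffun A -> T} -> K, exists2 b, b \in F &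
  exists i, forall g, g \in G -> chi (fcomp b g) = i.

(** This carries the omission of Henson constraints over from [B]: a constraint realised by edges
    would embed into [B]. *)
Definition cliques_in_B (T : finType) (e : T -> T -> nat -> Prop) :=
  forall (M : metric_space) (f : M -> T),
  (forall x y, x <> y -> e (f x) (f y) (distance x y)) ->
  exists f' : M -> B, forall x y, x <> y -> dB (f' x) (f' y) = distance x y.

Lemma edge_fcomp (T U : finType) (F : {set {ffun B -> T}})
    (Q : {set {ffun B -> U}}) (p : U -> T) :
  (forall b, b \in Q -> fcomp p b \in F) ->
  forall x y l, edge Q x y l -> edge F (p x) (p y) l.
Proof.
move=> QF x y l [b [u [v [bQ uv -> -> ->]]]].
by exists (fcomp p b), u, v; rewrite !ffunE; split=> //; apply: QF.
Qed.

Section Picture.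
Variables (T : finType) (F : {set {ffun B -> T}}).
Hypothesis F_inj : forall b, b \in F -> injective b.

(** The parts are the fibres of [p]. The last two clauses are conditional because the initial system
    need not have single-valued labels, while every picture has them. *)
Definition picture (U : finType) (Q : {set {ffun B -> U}}) (p : U -> T) :=
  [/\ forall b, b \in Q -> fcomp p b \in F,
      single_valued (edge Q),
      single_valued (edge F) -> forall k, good H (edge F) k ->
        good H (edge Q) k.+1
    & single_valued (edge F) -> cliques_in_B (edge Q)].

Definition copies_over (U : finType) (Q : {set {ffun B -> U}}) (p : U -> T)
    (al : {ffun A -> T}) : {set {ffun A -> U}} :=
  [set ga in [set fcomp b g | b : {ffun B -> U} in Q, g : {ffun A -> B} in G] | fcomp p ga == al].

(** * One step of the partite construction, for the copies of [A] over a fixed [al] *)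

Section Step.
Variables (U : finType) (Q : {set {ffun B -> U}}) (p : U -> T).
Hypothesis Qpic : picture Q p.
Variables (al : {ffun A -> T}) (ga0 : {ffun A -> U}).
Hypothesis ga0P : ga0 \in copies_over Q p al.

Let letter : finType := {ga | ga \in copies_over Q p al}.
Variables (I : finType) (i0 : I).

Let lines : finType :=
  {L : {ffun I -> option letter} | [exists i, L i == None]}.

Let moving (L : lines) : I := xchoose (existsP (valP L)).

Let movingP (L : lines) : val L (moving L) = None.
Proof. exact/eqP/(xchooseP (existsP (valP L))). Qed.

Let some_line_subproof : [exists i, [ffun _ : I => @None letter] i == None].
Proof. by apply/existsP; exists i0; rewrite ffunE. Qed.

Let some_line : lines :=
  exist (fun L : {ffun I -> option letter} => [exists i, L i == None])
    [ffun=> None] some_line_subproof.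

Let row (x : U) : option A := [pick r | al r == p x].

(** One copy of [U] for each line in the cube of words over the alphabet of copies of [A] above
    [al]. Points over [al] become words, shared between lines; all others are private to their
    line. *)
Let U' : finType := ({ffun I -> U} + lines * U)%type.

(** Fixed coordinates hold the [r]-th point of a letter. Moving ones hold [x], which need not belong
    to any letter. *)
Let fill (L : lines) (r : A) (x : U) : {ffun I -> U} :=
  [ffun i => if val L i is Some ga then val ga r else x].

Let inj_line (L : lines) (x : U) : U' :=
  if row x is Some r then inl (fill L r x) else inr (L, x).

Let Q' : {set {ffun B -> U'}} :=
  [set fcomp (inj_line L) b | L : lines in [set: lines], b : {ffun B -> U} in Q].

Let p' (x : U') : T :=
  match x with inl f => p (f i0) | inr Lx => p Lx.2 end.

Let copyP ga : ga \in copies_over Q p al ->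
  (exists b g, [/\ b \in Q, g \in G & ga = fcomp b g])
  /\ forall r, p (ga r) = al r.
Proof.
rewrite inE => /andP[/imset2P[b g bQ gG ->] /eqP <-]; split.
  by exists b, g.
by move=> r; rewrite !ffunE.
Qed.

Let rowP x r : row x = Some r -> p x = al r.
Proof. by rewrite /row; case: pickP => // s /eqP <- [->]. Qed.

Let al_edge r s : r <> s -> edge F (al r) (al s) (dA r s).
Proof.
move=> rs; have [[b [g [bQ gG ->]]] E] := copyP ga0P.
exists (fcomp p b), (g r), (g s); rewrite !ffunE; split.
- by case: Qpic => + _ _ _; apply.
- by move/(G_inj gG).
- by rewrite -E !ffunE.
- by rewrite -E !ffunE.
- by rewrite G_iso.
Qed.

Let edge_neq (V : finType) (E : {set {ffun B -> V}}) :
  (forall b, b \in E -> injective b) -> forall x y l, edge E x y l -> x <> y.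
Proof. by move=> Ei x y l [b [u [v [bE uv -> -> _]]]] /(Ei _ bE). Qed.

Let al_inj : injective al.
Proof.
move=> r s E; apply: contrapT => /al_edge /(edge_neq F_inj); exact.
Qed.

Let rowE x r : p x = al r -> row x = Some r.
Proof.
rewrite /row; case: pickP => [s /eqP <- /al_inj -> //|no E].
by have := no r; rewrite E eqxx.
Qed.

Let p'_inj_line L x : p' (inj_line L x) = p x.
Proof.
rewrite /inj_line; case E : (row x) => [r|] //=; rewrite ffunE.
case: (val L i0) => [ga|] //; rewrite (rowP E).
by have [_ ->] := copyP (valP ga).
Qed.

Let edge'P x y l : edge Q' x y l ->
  exists L u v, [/\ x = inj_line L u, y = inj_line L v & edge Q u v l].
Proof.
move=> [b' [s [t [/imset2P[L b _ bQ ->] st -> -> ->]]]].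
exists L, (b s), (b t); rewrite !ffunE; split=> //.
by exists b, s, t.
Qed.

Let edge_row u v l r s : edge Q u v l -> row u = Some r -> row v = Some s ->
  r <> s /\ edge F (al r) (al s) l.
Proof.
move=> e ru rv; have [QF _ _ _] := Qpic.
have := edge_fcomp QF e; rewrite (rowP ru) (rowP rv) => e'.
by split=> // rs; apply: (edge_neq F_inj e'); rewrite rs.
Qed.

Let letter_edge (ga : letter) r s : r <> s ->
  edge Q (val ga r) (val ga s) (dA r s).
Proof.
move=> rs; have [[b [g [bQ gG ->]]] _] := copyP (valP ga).
exists b, (g r), (g s); rewrite !ffunE; split=> //; first by move/(G_inj gG).
by rewrite G_iso.
Qed.

Let dom (L : lines) (x : U') : bool :=
  if x is inr Lx then Lx.1 == L else true.

Let phi (i : I) (x : U') : U :=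
  match x with inl f => f i | inr Lx => Lx.2 end.

Let phi_inj_line L x : phi (moving L) (inj_line L x) = x.
Proof. by rewrite /inj_line; case: (row x) => //= r; rewrite ffunE movingP. Qed.

(** An edge of another line with both ends shared goes to itself if the chosen coordinate moves
    there too. Otherwise it goes to an edge of a letter, with the same label because [F] is
    single-valued. *)
Let edge_phi L x y l : single_valued (edge F) -> dom L x -> dom L y ->
  edge Q' x y l -> edge Q (phi (moving L) x) (phi (moving L) y) l.
Proof.
move=> svF dx dy /edge'P[L' [u [v [xu yv e]]]].
case E: (L' == L).
  by move/eqP: E xu yv => -> -> ->; rewrite !phi_inj_line.
move: xu yv dx dy; rewrite /inj_line; case ru: (row u) => [r|] ->; last by rewrite /= E.
case rv: (row v) => [s|] ->; last by rewrite /= E.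
move=> _ _ /=; rewrite !ffunE; have [rs eF] := edge_row e ru rv.
case: (val L' _) => [ga|] //.
by rewrite (svF _ _ _ _ eF (al_edge rs)); apply: letter_edge.
Qed.

Let edge_inr L x y l : edge Q' (inr (L, x)) y l -> dom L y.
Proof.
move=> /edge'P[L' [u [v [+ -> _]]]]; rewrite /inj_line.
by case: (row u) => // -[-> _]; case: (row v) => //=; rewrite eqxx.
Qed.

Let edge_inl x f l : edge Q' x (inl f) l -> exists r, p' (inl f) = al r.
Proof.
move=> /edge'P[L [u [v [_ + _]]]]; rewrite {1}/inj_line.
case rv: (row v) => [r|] // [->]; exists r; rewrite -(rowP rv).
by rewrite -(p'_inj_line L) /inj_line rv.
Qed.

(** Either the walk stays among the shared words and the private points of [L], and then projects to
    [Q], or it is cut at a private point of another line. *)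
Let split_dom L x y n b s : single_valued (edge F) ->
  walk H (edge Q') x y n b s -> dom L x ->
  (walk H (edge Q) (phi (moving L) x) (phi (moving L) y) n b s /\ dom L y) \/
  exists L' z n1 b1 s1 n2 b2 s2,
  [/\ L' != L, walk H (edge Q') x (inr (L', z)) n1 b1 s1,
      walk H (edge Q') (inr (L', z)) y n2 b2 s2 &
      [/\ n = n1 + n2, b = b1 (+) b2 & s = s1 + s2]].
Proof.
move=> svF; elim=> [z|u v w l c m c' t e wv IH] du.
  by left; split=> //; apply: walk_nil.
case dv : (dom L v); last first.
  right; move: dv e wv; case: v {IH} => [//|[L' z]] /= L'L e wv.
  exists L', z, 1, c, (if c then H - l else l), m, c', t; split=> //.
    by rewrite L'L.
  exact: walk_edge.
case: (IH dv) => [[wq dw]|[L' [z [n1 [b1 [s1 [n2 [b2 [s2 [L'L w1 w2 [-> -> ->]]]]]]]]]]].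
  by left; split=> //; apply: walk_cons wq; apply: edge_phi.
right; exists L', z, n1.+1, (c (+) b1), ((if c then H - l else l) + s1), n2, b2, s2.
by split=> //; [apply: walk_cons w1 | rewrite addbA addnA addSn].
Qed.

(** Private points of different lines are not adjacent, so the walk passes through a shared word.
    Both halves have at least one step, which pays for the edge added when a closed walk is cut. *)
Let split_inl L x L' x' n b s : L' != L ->
  walk H (edge Q') (inr (L, x)) (inr (L', x')) n b s ->
  exists f n1 b1 s1 n2 b2 s2,
  [/\ exists r, p' (inl f) = al r,
      walk H (edge Q') (inr (L, x)) (inl f) n1.+1 b1 s1,
      walk H (edge Q') (inl f) (inr (L', x')) n2.+1 b2 s2 &
      [/\ n = n1.+1 + n2.+1, b = b1 (+) b2 & s = s1 + s2]].
Proof.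
move=> L'L; move: {-1}(inr (L, x) : U') (erefl (inr (L, x) : U')) => X EX.
move: {-1}(inr (L', x') : U') (erefl (inr (L', x') : U')) => Y EY w.
elim: w x EX EY => [z x <- [E _]|u v w l c m c' t e wv IH x Eu Ew].
  by rewrite E eqxx in L'L.
have := e; rewrite -Eu => /edge_inr; case: v e wv IH => [f|[L1 z]] e wv IH.
  move=> _; case: m wv IH => [|m] wv _; first by rewrite -Ew in wv; inversion wv.
  exists f, 0, c, (if c then H - l else l), m, c', t; split=> //.
    exact: edge_inl e.
  by rewrite Eu; apply: walk_edge.
move=> /= /eqP EL1; rewrite EL1 in e wv IH *.
have [f [n1 [b1 [s1 [n2 [b2 [s2 [fr w1 w2 [-> -> ->]]]]]]]]] := IH z erefl Ew.
exists f, n1.+1, (c (+) b1), ((if c then H - l else l) + s1), n2, b2, s2.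
by split=> //; [apply: walk_cons w1; rewrite -?Eu // Eu | rewrite addbA addnA addSn].
Qed.

Let p'_edge x y l : edge Q' x y l -> edge F (p' x) (p' y) l.
Proof.
move=> /edge'P[L [u [v [-> -> e]]]]; rewrite !p'_inj_line.
by case: Qpic => QF _ _ _; apply: (edge_fcomp QF).
Qed.

(* A closed walk through two different copies of [Q] crosses the common part
   twice, and the edge of [al] between the crossing points cuts its projection
   to [T] into two shorter closed walks. *)
Let good_two_lines k L x L' x' n b s n' b' s' : L' != L ->
  good H (edge F) k -> n + n' <= k.+1 -> b (+) b' = true ->
  walk H (edge Q') (inr (L, x)) (inr (L', x')) n b s ->
  walk H (edge Q') (inr (L', x')) (inr (L, x)) n' b' s' -> H <= s + s'.
Proof.
move=> L'L gF nk bb w w'.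
have [f [n1 [b1 [s1 [n2 [b2 [s2 [[r fr] w1 w2 [? ? ?]]]]]]]]] := split_inl L'L w.
have LL' : L != L' by rewrite eq_sym.
have [f' [n3 [b3 [s3 [n4 [b4 [s4 [[r' f'r] w3 w4 [? ? ?]]]]]]]]] := split_inl LL' w'.
subst; have := walk_map p'_edge (walk_cat w2 w3).
have := walk_map p'_edge (walk_cat w4 w1); rewrite fr f'r => v1 v2.
have bb' : (b4 (+) b1) (+) (b2 (+) b3) = true.
  by move: bb; case: (b1); case: (b2); case: (b3); case: (b4).
have -> : s1 + s2 + (s3 + s4) = (s4 + s1) + (s2 + s3) by lia.
move: (b4 (+) b1) (b2 (+) b3) (s4 + s1) (s2 + s3) v1 v2 bb' => c c' t t' v1 v2 cc.
have [E|/eqP rr] := eqVneq r r'.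
  subst r'; case: c c' v1 v2 cc => -[] // v1 v2 _.
    by apply: leq_trans (leq_addr _ _); apply: gF v1; lia.
  by apply: leq_trans (leq_addl _ _); apply: gF v2; lia.
have := dA_le r r'; have e1 c1 := walk_cat v1 (walk_edge H c1 (al_edge rr)).
have e2 c1 := walk_cat v2 (walk_edge H c1 (al_edge (nesym rr))).
rewrite (dA_sym r' r) in e2.
(* The edge is flipped in exactly one of the two closed walks: both become odd, and its two
   contributions add up to [H]. *)
case: c c' v1 v2 cc e1 e2 => -[] // _ _ _ e1 e2.
  have := gF _ _ _ _ (e1 false); have := gF _ _ _ _ (e2 true); lia.
have := gF _ _ _ _ (e1 true); have := gF _ _ _ _ (e2 false); lia.
Qed.

(** Two lines through the same edge are compared at a coordinate moving in the first. Either it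
    moves in the second too, or the label is that of a pair of [A]. Unlike in [edge_phi], [F] is not
    assumed single-valued. *)
Let sv_step : single_valued (edge Q').
Proof.
have [QF svQ _ _] := Qpic.
suff main x y l l' : edge Q' x y l -> edge Q' x y l' -> l = l' \/
    exists r s, [/\ p' x = al r, p' y = al s & l = dA r s].
  move=> x y l l' e e'; case: (main _ _ _ _ e e') => // -[r [s [xr ys lE]]].
  case: (main _ _ _ _ e' e) => [//|[r' [s' []]]].
  by rewrite xr ys lE => /al_inj -> /al_inj ->.
move=> /edge'P[L1 [u1 [v1 [xu1 yv1 e1]]]] /edge'P[L2 [u2 [v2 [xu2 yv2 e2]]]].
have [E|L12] := eqVneq L1 L2.
  left; subst L2; apply: (svQ u1 v1) => //.
  rewrite -(phi_inj_line L1 u1) -(phi_inj_line L1 v1) -xu1 -yv1 xu2 yv2.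
  by rewrite !phi_inj_line.
have xp : phi (moving L1) x = u1 by rewrite xu1 phi_inj_line.
have yp : phi (moving L1) y = v1 by rewrite yv1 phi_inj_line.
move: xu1 yv1 xu2 yv2 xp yp; rewrite /inj_line.
case ru1: (row u1) => [r|] ->; last first.
  by move=> _; case: (row u2) => // -[E]; rewrite E eqxx in L12.
case rv1: (row v1) => [s|] ->; last first.
  by move=> _; case: (row v2) => // -[E]; rewrite E eqxx in L12.
case ru2: (row u2) => [r2|] // -[Eu]; case rv2: (row v2) => [s2|] // -[Ev].
have Er : p' (inl (fill L1 r u1)) = al r.
  by rewrite -(rowP ru1) -(p'_inj_line L1) /inj_line ru1.
have Es : p' (inl (fill L1 s v1)) = al s.
  by rewrite -(rowP rv1) -(p'_inj_line L1) /inj_line rv1.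
have Er2 : r2 = r.
  apply: al_inj; rewrite -Er Eu -(rowP ru2) -(p'_inj_line L2) /inj_line ru2 //.
have Es2 : s2 = s.
  apply: al_inj; rewrite -Es Ev -(rowP rv2) -(p'_inj_line L2) /inj_line rv2 //.
rewrite Er Es Eu Ev Er2 Es2 /= !ffunE.
case: (val L2 (moving L1)) => [ga|] Eu1 Ev1; last first.
  by left; apply: (svQ u1 v1) => //; rewrite -Eu1 -Ev1.
right; exists r, s; split=> //; apply: (svQ u1 v1) => //.
by rewrite -Eu1 -Ev1; apply: letter_edge; have [] := edge_row e1 ru1 rv1.
Qed.

(** A closed walk projects to [Q], or it visits a private point and may be rotated to start there;
    if it then meets a second line, [good_two_lines] applies. *)
Let good_step k : single_valued (edge F) -> good H (edge F) k ->
  good H (edge Q') k.+1.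
Proof.
move=> svF gF; have [_ _ /(_ svF k gF) gQ _] := Qpic.
have good_inr L x n s : n <= k.+1 ->
    walk H (edge Q') (inr (L, x)) (inr (L, x)) n true s -> H <= s.
  move=> nk w; case: (split_dom svF w (eqxx L)) => [[w' _]|]; first exact: gQ w'.
  move=> [L' [z [n1 [b1 [s1 [n2 [b2 [s2 [L'L w1 w2 [En Eb ->]]]]]]]]]].
  by apply: (good_two_lines L'L gF _ _ w1 w2); rewrite -?En // -Eb.
case=> [f|[L x]] n s nk w; last exact: good_inr w.
case: (split_dom (L := some_line) svF w isT) => [[w' _]|]; first exact: gQ w'.
move=> [L' [z [n1 [b1 [s1 [n2 [b2 [s2 [_ w1 w2 [En Eb Es]]]]]]]]]].
have := walk_cat w2 w1; rewrite addbC -Eb addnC -En addnC -Es; exact: good_inr.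
Qed.

(** Private points of distinct lines are never adjacent, so a clique has private points of at most
    one line and projects to [Q]. *)
Let cliques_step : single_valued (edge F) -> cliques_in_B (edge Q').
Proof.
move=> svF M f fM; have [_ _ _ /(_ svF) cQ] := Qpic.
have [L LM] : exists L, forall m, dom L (f m).
  have [[m0 [L [x fm0]]]|no] := pselect (exists m L x, f m = inr (L, x)).
    exists L => m; have [<-|mm] := pselect (m0 = m); first by rewrite fm0 /= eqxx.
    by have := fM _ _ mm; rewrite fm0 => /edge_inr.
  exists some_line => m; case E: (f m) => [//|[L x]].
  by case: no; exists m, L, x.
apply: (cQ M (phi (moving L) \o f)) => x y xy.
by apply: edge_phi => //; apply: fM.
Qed.

(** By Hales-Jewett over the alphabet of copies above [al], a monochromatic line is a copy of [Q] in
    which all these copies have one colour. *)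
Lemma partite_step_nonempty :
  (forall C : {ffun I -> letter} -> K,
    exists2 l : {ffun I -> option letter}, exists i, l i = None &
    forall x y, C (line_point l x) = C (line_point l y)) ->
  exists (V : finType) (R : {set {ffun B -> V}}) (q : V -> T), picture R q /\
  forall chi : {ffun A -> V} -> K, exists h : U -> V,
  [/\ forall x, q (h x) = p x, forall b, b \in Q -> fcomp h b \in R &
      forall ga ga', ga \in copies_over Q p al -> ga' \in copies_over Q p al ->
      chi (fcomp h ga) = chi (fcomp h ga')].
Proof.
move=> HI; have [QF _ _ _] := Qpic; exists U', Q', p'; split.
  split; [|exact: sv_step|by move=> ? ? ?; exact: good_step|exact: cliques_step].
  move=> b' /imset2P[L b _ bQ ->]; rewrite fcompA.
  by have -> : fcomp (p' \o inj_line L) b = fcomp p b;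
    [apply/ffunP => x; rewrite !ffunE /= p'_inj_line | exact: QF].
(* A word of letters, read row by row, is a map from [A] into the shared words. *)
move=> chi; pose C (w : {ffun I -> letter}) :=
  chi [ffun r => inl [ffun i => val (w i) r]].
have [l [i li] lC] := HI C.
have lP : [exists i, l i == None] by apply/existsP; exists i; rewrite li.
pose L : lines := exist _ l lP.
exists (inj_line L); split=> [x|b bQ|ga ga' gaP ga'P]; first exact: p'_inj_line.
  by apply/imset2P; exists L b.
have E (ga1 : letter) : fcomp (inj_line L) (val ga1) =
    [ffun r => inl [ffun i => val (line_point l ga1 i) r]].
  apply/ffunP => r; rewrite !ffunE /inj_line (rowE (r := r)); last first.
    by have [_ ->] := copyP (valP ga1).
  by congr inl; apply/ffunP => j; rewrite !ffunE; case: (l j).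
by have := lC (exist _ ga gaP) (exist _ ga' ga'P); rewrite /C -!E.
Qed.

End Step.

Lemma partite_step (U : finType) (Q : {set {ffun B -> U}}) (p : U -> T)
    (al : {ffun A -> T}) : picture Q p ->
  exists (V : finType) (R : {set {ffun B -> V}}) (q : V -> T), picture R q /\
  forall chi : {ffun A -> V} -> K, exists h : U -> V,
  [/\ forall x, q (h x) = p x, forall b, b \in Q -> fcomp h b \in R &
      forall ga ga', ga \in copies_over Q p al -> ga' \in copies_over Q p al ->
      chi (fcomp h ga) = chi (fcomp h ga')].
Proof.
move=> Qpic; have [E|[ga0 ga0P]] := set_0Vmem (copies_over Q p al).
  exists U, Q, p; split=> // chi; exists id; split=> //.
    by move=> b bQ; have -> : fcomp id b = b by apply/ffunP => x; rewrite ffunE.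
  by move=> ga ga'; rewrite E inE.
have [I HI] := hales_jewett {ga | ga \in copies_over Q p al} K.
have [_ [i0 _] _] := HI (fun=> k0).
by apply: (partite_step_nonempty Qpic ga0P i0 HI).
Qed.

(** Pictures are built for one [al] after another; a colouring of the last one is pulled back
    through them in reverse order. *)
Lemma partite_steps (als : seq {ffun A -> T}) (U : finType)
    (Q : {set {ffun B -> U}}) (p : U -> T) : picture Q p ->
  exists (V : finType) (R : {set {ffun B -> V}}) (q : V -> T), picture R q /\
  forall chi : {ffun A -> V} -> K, exists h : U -> V,
  [/\ forall x, q (h x) = p x, forall b, b \in Q -> fcomp h b \in R &
      forall al ga ga', al \in als ->
      ga \in copies_over Q p al -> ga' \in copies_over Q p al ->
      chi (fcomp h ga) = chi (fcomp h ga')].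
Proof.
elim: als U Q p => [|al als IH] U Q p Qpic.
  exists U, Q, p; split=> // chi; exists id; split=> //.
  by move=> b bQ; have -> : fcomp id b = b by apply/ffunP => x; rewrite ffunE.
have [V [R [q [Rpic hR]]]] := IH U Q p Qpic.
have [W [S [o [Spic hS]]]] := partite_step al Rpic.
exists W, S, o; split=> // chi.
have [h2 [oh2 RS h2al]] := hS chi.
have [h1 [qh1 QR h1als]] := hR (fun ga => chi (fcomp h2 ga)).
exists (h2 \o h1); split=> [x|b bQ|al' ga ga'].
- by rewrite /= oh2.
- by rewrite -fcompA; apply/RS/QR.
rewrite inE -!(fcompA h2 h1) => /orP[/eqP->|al'P gaP ga'P]; last exact: (h1als al').
have lift ga1 : ga1 \in copies_over Q p al -> fcomp h1 ga1 \in copies_over R q al.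
  rewrite !inE (fcompA q h1) => /andP[/imset2P[b g bQ gG ->] /eqP <-]; apply/andP; split.
    by apply/imset2P; exists (fcomp h1 b) g; rewrite ?QR //; apply/ffunP => r; rewrite !ffunE.
  by apply/eqP/ffunP => r; rewrite !ffunE /= qh1.
by move=> /lift gaP /lift ga'P; apply: h2al.
Qed.

(** Start from disjoint copies of [B], one for each member of [F]; they are good by [walk_metric].
    After the steps, in some image of this start, the colour of a copy of [A] depends only on its
    projection to [T], and the Ramsey property of [F] applies. *)
Lemma stage : ramsey_system F ->
  exists (V : finType) (R : {set {ffun B -> V}}) (q : V -> T),
  picture R q /\ ramsey_system R.
Proof.
move=> FR; pose U : finType := ({ffun B -> T} * B)%type.
pose Q : {set {ffun B -> U}} :=
  [set [ffun x => (b, x)] | b : {ffun B -> T} in F].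
pose p (x : U) : T := x.1 x.2.
have edge_snd x y l : edge Q x y l -> l = dB x.2 y.2.
  by move=> [_ [u [v [/imsetP[b _ ->] _ -> -> ->]]]]; rewrite !ffunE.
have Qpic : picture Q p.
  split.
  - move=> _ /imsetP[b bF ->].
    by have -> : fcomp p [ffun x => (b, x)] = b by apply/ffunP => x; rewrite !ffunE.
  - by move=> x y l l' /edge_snd-> /edge_snd->.
  - move=> _ k _ x n s _ w0.
    have w := walk_map (e' := fun x y l => l = dB x y) (f := snd) edge_snd w0.
    by have := walk_metric dB0 dB_sym dB_tri dB_per w; rewrite dB0 subn0.
  - move=> _ M f fM; exists (snd \o f) => x y /fM /edge_snd -> //.
have [V [R [q [Rpic hR]]]] := partite_steps (enum {ffun A -> T}) Qpic.
exists V, R, q; split=> // chi; have [h [qh QR hal]] := hR chi.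
pose chi' (al : {ffun A -> T}) : K :=
  odflt k0 (omap (fun ga => chi (fcomp h ga)) [pick ga in copies_over Q p al]).
have [b bF [i bi]] := FR chi'.
have bQ : [ffun x => (b, x)] \in Q by apply/imsetP; exists b.
exists (fcomp h [ffun x => (b, x)]); first exact: QR.
exists i => g gG; rewrite -(bi g gG) /chi'.
have gP : fcomp [ffun x => (b, x)] g \in copies_over Q p (fcomp b g).
  rewrite inE; apply/andP; split; first by apply/imset2P; exists [ffun x => (b, x)] g.
  by apply/eqP/ffunP => r; rewrite !ffunE.
case: pickP => [ga gaP /=|/(_ (fcomp [ffun x => (b, x)] g))]; last by rewrite gP.
rewrite -(hal (fcomp b g) _ _ (mem_enum _ _) gP gaP); congr chi.
by apply/ffunP => r; rewrite !ffunE.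
Qed.

End Picture.

Lemma stages (T0 : finType) (F0 : {set {ffun B -> T0}}) :
  (forall b, b \in F0 -> injective b) -> ramsey_system F0 ->
  forall j, exists (T : finType) (F : {set {ffun B -> T}}) (q : T -> T0),
  [/\ forall b, b \in F -> fcomp q b \in F0, ramsey_system F,
      single_valued (edge F), good H (edge F) j & cliques_in_B (edge F)].
Proof.
move=> F0_inj F0R.
have lift_inj (T : finType) (F : {set {ffun B -> T}}) (q : T -> T0) :
    (forall b, b \in F -> fcomp q b \in F0) -> forall b, b \in F -> injective b.
  by move=> FF0 b bF x y E; apply: (F0_inj _ (FF0 _ bF)); rewrite !ffunE E.
have lift_comp (T U : finType) (F : {set {ffun B -> T}}) (q : T -> T0)
    (R : {set {ffun B -> U}}) (p : U -> T) : (forall b, b \in F -> fcomp q b \in F0) ->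
    (forall b, b \in R -> fcomp p b \in F) -> forall b, b \in R -> fcomp (q \o p) b \in F0.
  by move=> FF0 RF b bR; rewrite -(fcompA q p); apply/FF0/RF.
elim=> [|j [T [F [q [FF0 FR svF gF _]]]]].
  (* The first round makes labels single-valued; this is what lets the second one force cliques into
     [B]. *)
  have [T [F [q [[FF0 svF _ _] FR]]]] := stage F0_inj F0R.
  have [U [R [p [[RF svR _ cR] RR]]]] := stage (lift_inj _ _ _ FF0) FR.
  exists U, R, (q \o p); split=> //; [exact: (lift_comp _ _ _ _ _ _ FF0 RF)|exact: good0|exact: cR].
have [U [R [p [[RF svR gR cR] RR]]]] := stage (lift_inj _ _ _ FF0) FR.
by exists U, R, (q \o p); split=> //; [exact: (lift_comp _ _ _ _ _ _ FF0 RF)|exact: gR|exact: cR].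
Qed.

End Systems.

(** * Completion of labelled graphs *)

(** [P] comes first for convexity, then [rho] for the order to be preserved; [enum_rank] breaks
    ties. *)
Definition lex_le (T : finType) (P : pred T) (rho : T -> nat) : rel T :=
  fun x y => (P x && ~~ P y) || (P x == P y) &&
    ((rho x < rho y) || (rho x == rho y) && (enum_rank x <= enum_rank y)).

Lemma lex_le_convex (T : finType) (P : pred T) (rho : T -> nat) :
  convex_order (lex_le P rho) P.
Proof.
split; last by move=> u v; rewrite /lex_le; case: (P u); case: (P v).
split.
- by move=> x; rewrite /lex_le !eqxx /= leqnn !orbT.
- move=> x y; rewrite /lex_le => le2; apply: enum_rank_inj; apply: ord_inj.
  by move: le2; rewrite /= ; case: (P x); case: (P y) => /=; lia.
- move=> y x z; rewrite /lex_le.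
  by case: (P x); case: (P y); case: (P z) => //=; lia.
- by move=> x y; rewrite /lex_le; case: (P x); case: (P y) => //=; lia.
Qed.

Lemma lex_le_embedding (B : Type) (le : rel B) (PB : pred B) (T : finType)
    (P : pred T) (rho : T -> nat) (f : B -> T) :
  convex_order le PB -> (forall x, P (f x) = PB x) ->
  (forall x y, x <> y -> le x y -> PB x = PB y -> rho (f x) < rho (f y)) ->
  forall x y, lex_le P rho (f x) (f y) = le x y.
Proof.
move=> [[le_refl le_anti le_trans le_total] conv] Pf rhof x y; rewrite /lex_le !Pf.
have [<-|xy] := pselect (x = y); first by rewrite !eqxx /= leqnn le_refl !orbT.
have := le_total x y; have := conv x y; have := conv y x; have := rhof x y xy.
have := rhof y x (nesym xy); have : ~ (le x y && le y x) by move/le_anti.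
case: (PB x); case: (PB y); case: (le x y); case: (le y x) => //=; lia.
Qed.

Section Completion.
Variables (delta C0 : nat) (HS : metric_space -> Prop).
Hypothesis hdelta : 3 <= delta.
Hypothesis hC0_gt : 2 * delta + 3 < C0.
Hypothesis hC0_even : ~~ odd C0.
Hypothesis hS : admissible delta C0 HS.

(** [C0 - 2], twice [H], is the largest even perimeter allowed. *)
Let H := (C0 - 2)./2.
Let HE : H.*2 + 2 = C0. Proof. by rewrite /H; lia. Qed.
Let H_gt : delta < H. Proof. by have := HE; lia. Qed.

Variables (T : finType) (e : T -> T -> nat -> Prop) (P : pred T).
Hypothesis e_sym : forall x y l, e x y l -> e y x l.
Hypothesis e_lab : forall x y l, e x y l -> 0 < l <= delta.
Hypothesis e_par : forall x y l, e x y l -> odd l = (P x (+) P y).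
Hypothesis e_good : good H e H.

Lemma walk_parity x y n b s : walk H e x y n b s ->
  odd s = (P x (+) P y) (+) (b && odd H).
Proof.
elim=> [u|u v w l c m c' t e1 _ IH]; first by rewrite addbb.
rewrite oddD {}IH; have := e_lab e1; have := e_par e1; case: c => /= El ll.
  rewrite oddB ?El; last by lia.
  by case: (odd H); case: (P u); case: (P v); case: (P w); case: c'.
by rewrite El; case: (odd H); case: (P u); case: (P v); case: (P w); case: c'.
Qed.

(** As [delta < H], every step has length at least 1, and an odd walk contains a flipped step, of
    length at least [H - delta]. *)
Lemma walk_weight x y n b s : walk H e x y n b s ->
  if b then H - delta + n <= s.+1 else n <= s.
Proof.
elim=> [//|u v w l c m c' t /e_lab ll _]; move: H_gt.
by case: c; case: c' => /=; lia.
Qed.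

Lemma closed_walk_ge x n s : walk H e x x n true s -> H <= s.
Proof.
move=> w; have [nH|Hn] := leqP n H; first exact: e_good w.
by have := walk_weight w; lia.
Qed.

Let pre_wmin b x y : exists s, (s == H) || `[< exists n, walk H e x y n b s >].
Proof. by exists H; rewrite eqxx. Qed.

(* Truncated at [H], which also covers the pairs joined by no walk. *)
Definition wmin b x y := ex_minn (pre_wmin b x y).

Lemma wmin_le b x y n s : walk H e x y n b s -> wmin b x y <= s.
Proof.
rewrite /wmin; case: ex_minnP => m _ mmin w; apply: mmin.
by apply/orP; right; apply/asboolP; exists n.
Qed.

Lemma wmin_H b x y : wmin b x y <= H.
Proof. by rewrite /wmin; case: ex_minnP => m _; apply; rewrite eqxx. Qed.

Lemma wmin_walk b x y : wmin b x y = H \/ exists n, walk H e x y n b (wmin b x y).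
Proof.
by rewrite /wmin; case: ex_minnP => m /orP[/eqP->|/asboolP w] _; [left|right].
Qed.

Lemma wmin_tri b c x y z : wmin (b (+) c) x z <= wmin b x y + wmin c y z.
Proof.
have := wmin_H (b (+) c) x z.
have [->|[n w]] := wmin_walk b x y; first by lia.
have [->|[n' w']] := wmin_walk c y z; first by lia.
by move=> _; apply: wmin_le (walk_cat w w').
Qed.

Lemma wmin_sym b x y : wmin b x y = wmin b y x.
Proof.
have le u v : wmin b u v <= wmin b v u.
  have := wmin_H b u v; have [->|[n w]] := wmin_walk b v u => // _.
  exact: wmin_le (walk_rev e_sym w).
by apply/eqP; rewrite eqn_leq !le.
Qed.

Lemma wmin_gt0 x y : x <> y -> 0 < wmin false x y.
Proof.
move=> xy; have [->|[[|n] w]] := wmin_walk false x y; first by lia.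
  by inversion w.
exact: leq_trans (walk_weight w).
Qed.

Lemma wmin_true x y : H - delta <= wmin true x y.
Proof.
have [->|[[|n] w]] := wmin_walk true x y; [exact: leq_subr|by inversion w|].
by have := walk_weight w; lia.
Qed.

(** A walk from [x] to [y] and one back form a closed walk. So the lower bound [H - wmin true x y]
    never exceeds the upper bound [wmin false x y]. *)
Lemma wmin_add x y : H <= wmin false x y + wmin true x y.
Proof.
have [->|[n w]] := wmin_walk false x y; first exact: leq_addr.
have [->|[n' w']] := wmin_walk true x y; first exact: leq_addl.
exact: closed_walk_ge (walk_cat w (walk_rev e_sym w')).
Qed.

Definition default_dist x y :=
  if odd delta./2 == (P x (+) P y) then delta./2 else delta./2.+1.

Definition completed_dist (x y : T) :=
  if x == y then 0 else
  if wmin false x y < default_dist x y then wmin false x y else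
  if default_dist x y < H - wmin true x y then H - wmin true x y
  else default_dist x y.

(** The default lies between 1 and [delta], so a bound that replaces it does not come from the
    truncation at [H]: it comes from an actual walk and has the right parity. The conditional
    clauses put the three cases into a form suited to linear arithmetic. *)
Lemma completed_distP x y : x <> y -> let d := completed_dist x y in
  [/\ 0 < d <= delta, odd d = (P x (+) P y),
      d <= wmin false x y /\ (d < wmin false x y -> default_dist x y <= d) &
      H <= d + wmin true x y /\
      (H < d + wmin true x y -> d <= default_dist x y)].
Proof.
move=> xy /=; rewrite /completed_dist; case: eqP => // _.
have := wmin_gt0 xy; have := wmin_true x y; have := wmin_add x y.
have := wmin_H true x y.
have M1 : 0 < default_dist x y <= delta by rewrite /default_dist; case: ifP; lia.
have M2 : odd (default_dist x y) = (P x (+) P y).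
  by rewrite /default_dist; case: ifP; case: (P x); case: (P y) => //=; lia.
case: ifP => [pM|pM]; last case: ifP => [qM|qM].
- move=> ? ? ? ?; split=> //; try lia.
  have [E|[n /walk_parity ->]] := wmin_walk false x y; [lia|by rewrite addbF].
- move=> ? ? ? ?; split=> //; try lia.
  have [E|[n /walk_parity E]] := wmin_walk true x y; first by lia.
  by rewrite oddB ?E; [case: (odd H); case: (P x); case: (P y) | lia].
- by move=> ? ? ? ?; split=> //; lia.
Qed.

Lemma completed_dist_sym x y : completed_dist x y = completed_dist y x.
Proof.
by rewrite /completed_dist eq_sym !(wmin_sym _ x y) /default_dist addbC.
Qed.

Lemma default_distP x y : let M := default_dist x y in
  [/\ delta./2 <= M <= delta./2.+1 & odd M = (P x (+) P y)].
Proof.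
rewrite /default_dist; case: ifP; first by move/eqP->; split=> //; lia.
by case: (P x); case: (P y) => /=; split; lia.
Qed.

Lemma completed_dist_tri x y z :
  completed_dist x z <= completed_dist x y + completed_dist y z.
Proof.
have [->|/eqP xy] := eqVneq x y; first exact: leq_addl.
have [->|/eqP yz] := eqVneq y z; first exact: leq_addr.
have [->|/eqP xz] := eqVneq x z; first by rewrite {1}/completed_dist eqxx.
have [b1 o1 [p1 p1'] [q1 q1']] := completed_distP xy.
have [b2 o2 [p2 p2'] [q2 q2']] := completed_distP yz.
have [b3 o3 [p3 p3'] [q3 q3']] := completed_distP xz.
have := wmin_tri false false x y z; have := wmin_tri true false x z y.
have := wmin_tri false true y x z; rewrite (wmin_sym _ z y) (wmin_sym _ y x) /=.
have := default_distP x y; have := default_distP y z; have := default_distP x z.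
move=> /= [c3 oc3] [c2 oc2] [c1 oc1].
have o4 : odd (default_dist x y) (+) odd (default_dist y z)
          = odd (completed_dist x z).
  by rewrite oc1 oc2 o3; case: (P x); case: (P y); case: (P z).
move=> {p3' q1' q2' o1 o2 o3 oc1 oc2 oc3} w1 w2 w3.
(* If both sides attain their upper bounds, these add up. If neither does, both are at least their
   defaults, and parity settles odd [delta]. If just one does, the third side is at most its
   default, or attains its lower bound and is controlled by [wmin_tri] with one flip. *)
case: (ltnP (completed_dist x y) (wmin false x y)) => [/p1' m1|lp1];
  case: (ltnP (completed_dist y z) (wmin false y z)) => [/p2' m2|lp2];
  move=> {p1' p2'}.
- by move=> {q3' p1 p2 p3 q1 q2 q3 w1 w2 w3}; lia.
- case: (ltnP H (completed_dist x z + wmin true x z)) => [/q3' m3|lq3];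
  by move=> {q3' o4}; lia.
- case: (ltnP H (completed_dist x z + wmin true x z)) => [/q3' m3|lq3];
  by move=> {q3' o4}; lia.
- by move=> {q3' o4}; lia.
Qed.

(** If two distances attain their lower bounds, joining the two odd walks bounds the third.
    Otherwise two are at most [delta./2 + 1] and the third at most [delta], and
    [2 * delta + 2 <= 2 * H]. *)
Lemma completed_dist_per x y z : x <> y -> y <> z -> x <> z ->
  completed_dist x y + completed_dist y z + completed_dist x z <= H.*2.
Proof.
move=> xy yz xz.
have [b1 o1 [p1 p1'] [q1 q1']] := completed_distP xy.
have [b2 o2 [p2 p2'] [q2 q2']] := completed_distP yz.
have [b3 o3 [p3 p3'] [q3 q3']] := completed_distP xz.
have := wmin_tri true true x y z; have := wmin_tri true true x z y.
have := wmin_tri true true y x z; rewrite (wmin_sym _ z y) (wmin_sym _ y x) /=.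
have := default_distP x y; have := default_distP y z; have := default_distP x z.
move=> /= [c3 _] [c2 _] [c1 _].
lia.
Qed.

(** The edge and its flip force both bounds to be [l]. *)
Lemma completed_dist_edge x y l : e x y l -> completed_dist x y = l.
Proof.
move=> exy; have ll := e_lab exy.
have xy : x <> y.
  move=> E; move: exy; rewrite E => exy.
  by have := closed_walk_ge (walk_edge H true exy); lia.
have [b1 o1 [p1 p1'] [q1 q1']] := completed_distP xy.
have := wmin_le (walk_edge H false exy); have := wmin_le (walk_edge H true exy).
by have := wmin_add x y; lia.
Qed.

(** For even [delta] neither 1 nor [delta] is a default value. The distance thus comes from a walk
    of length 1, or an odd one of length [H - delta], and such a walk has a single step. *)
Lemma completed_dist_extreme x y d : ~~ odd delta -> x <> y ->
  d = 1 \/ d = delta -> completed_dist x y = d -> e x y d.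
Proof.
move=> ev xy d1; rewrite /completed_dist; case: eqP => // _.
have [M _] := default_distP x y.
have := wmin_H true x y.
case: ifP => [pM _ pd|pM]; last case: ifP => [qM _ qd|qM]; last by lia.
  have [E|[n w]] := wmin_walk false x y; first by lia.
  have E : d = 1 by lia.
  rewrite pd E in w *; have := walk_weight w; case: n w => [|[|n]] w // _.
    by inversion w.
  by have [l exy ->] := walk1_edge w.
have [E|[n w]] := wmin_walk true x y; first by lia.
have E : d = delta by lia.
have {}qd : wmin true x y = H - delta by have := wmin_H true x y; lia.
rewrite qd in w; rewrite E; have := walk_weight w; case: n w => [|[|n]] w.
- by inversion w.
- have [l exy El] := walk1_edge w.
  by have ll := e_lab exy; have -> : delta = l by lia.
- by move: H_gt; lia.
Qed.

Hypothesis e_omit : forall M : metric_space, HS M -> ~ exists f : M -> T,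
  forall x y, x <> y -> e (f x) (f y) (distance x y).

Let K := fun A : fin_metric_space => bipartite_class delta C0 A /\ omits HS A.

Lemma completion (rho : T -> nat) : exists m : metric T,
  convex_expansions K (Expansion (A := FinMetricSpace m) (lex_le P rho) P) /\
  forall x y l, e x y l -> m x y = l.
Proof.
have d0 x y : completed_dist x y = 0 <-> x = y.
  split=> [|->]; last by rewrite /completed_dist eqxx.
  by move=> E; apply: contrapT => /completed_distP[]; rewrite E.
have parE x y : odd (completed_dist x y) = (P x (+) P y).
  have [->|/eqP/completed_distP[] //] := eqVneq x y.
  by rewrite /completed_dist eqxx addbb.
exists (Metric d0 completed_dist_sym completed_dist_tri).
split; last exact: completed_dist_edge.
split; last exact: lex_le_convex; last first.
  move=> u v; rewrite /distance /= parE.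
  by case: (P u); case: (P v); split.
split; first split.
- by move=> x y /completed_distP[].
- move=> x y z xy yz xz; rewrite /distance /=.
  have := completed_dist_per xy yz xz; have := HE => HE' per [|[_]]; last by lia.
  by rewrite !oddD !parE; case: (P x); case: (P y); case: (P z).
move=> M HM [f fM]; have [hen [g g_inj] noT] := hS HM.
have f_inj x y : x <> y -> f x <> f y.
  by move=> xy E; apply: xy; apply/(dist_eq0 (space_metric M)); rewrite -[LHS]fM; apply/d0.
(* For odd [delta] any three points of a constraint have odd perimeter, so no constraint exists. For
   even [delta] the distances in the copy must all be edges. *)
have [od|ev] := boolP (odd delta).
  have neq i j : i != j -> g i <> g j by move=> ij /g_inj; apply/eqP.
  pose i k : 'I_4 := inord k.
  have n01 : g (i 0) <> g (i 1) by apply: neq; rewrite -val_eqE /= !inordK.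
  have n12 : g (i 1) <> g (i 2) by apply: neq; rewrite -val_eqE /= !inordK.
  have n02 : g (i 0) <> g (i 2) by apply: neq; rewrite -val_eqE /= !inordK.
  apply: (noT _ _ _ n01 n12 n02); left; rewrite !oddD.
  by case: (hen _ _ n01) => ->; case: (hen _ _ n12) => ->;
    case: (hen _ _ n02) => ->; rewrite ?od.
apply: (e_omit HM); exists f => x y xy.
by apply: completed_dist_extreme => //; [exact: f_inj | exact: hen].
Qed.

End Completion.

(** * Ordered copies *)

Lemma dist0 (A : fin_metric_space) x : fin_space_metric A x x = 0.
Proof. exact/dist_eq0. Qed.

Lemma map_sort_subseq (A B : finType) (leA : rel A) (leB : rel B) (g : A -> B) :
  linear_order leA -> linear_order leB ->
  (forall x y, leB (g x) (g y) = leA x y) ->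
  subseq (map g (sort leA (enum A))) (sort leB (enum B)).
Proof.
move=> [reflA antiA transA totA] [reflB antiB transB totB] gle.
have g_inj : injective g.
  by move=> x y E; apply: antiA; rewrite -!gle E reflB.
have -> : map g (sort leA (enum A))
          = [seq y <- sort leB (enum B) | y \in codom g].
  apply: (sorted_eq transB antiB).
  - by apply: homo_sorted (sort_sorted totA _) => x y; rewrite gle.
  - exact/(sorted_filter transB)/sort_sorted.
  apply: uniq_perm.
  - by rewrite map_inj_uniq // sort_uniq enum_uniq.
  - by rewrite filter_uniq // sort_uniq enum_uniq.
  move=> y; rewrite mem_filter mem_sort mem_enum andbT.
  apply/mapP/codomP => [[x _ ->]|[x ->]]; first by exists x.
  by exists x; rewrite // mem_sort mem_enum.
exact: filter_subseq.
Qed.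

Lemma index_sort_lt (B : finType) (le : rel B) : linear_order le ->
  forall x y, x <> y -> le x y ->
  index x (sort le (enum B)) < index y (sort le (enum B)).
Proof.
move=> [_ anti trans tot] x y xy le_xy.
have memB z : z \in sort le (enum B) by rewrite mem_sort mem_enum.
rewrite ltn_neqAle leqNgt; apply/andP; split.
  by apply/eqP => E; apply: xy; apply: (index_inj x (memB x) (memB y)).
apply/negP => /(sorted_ltn_index trans (sort_sorted tot _) y x (memB y) (memB x)) le_yx.
by apply: xy; apply: anti; rewrite le_xy.
Qed.

(** Sorted by their orders, [A] and [B] become lists and an embedding becomes a subsequence, so
    Ramsey's theorem for subsequences of [iota 0 N] applies. *)
Lemma ordered_ramsey (A B : finType) (leA : rel A) (leB : rel B) (K : finType) :
  linear_order leA -> linear_order leB -> K ->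
  exists N, forall chi : {ffun A -> 'I_N} -> K, exists2 b : {ffun B -> 'I_N},
  forall x y, x <> y -> leB x y -> b x < b y &
  exists i, forall g : A -> B, (forall x y, leB (g x) (g y) = leA x y) ->
  chi [ffun r => b (g r)] = i.
Proof.
move=> linA linB k0; have [N HN] := ramsey_seq nat k0 #|A| #|B|; exists N.+1 => chi.
pose sA := sort leA (enum A); pose sB := sort leB (enum B).
have memA r : r \in sA by rewrite mem_sort mem_enum.
have memB x : x \in sB by rewrite mem_sort mem_enum.
have szA : size sA = #|A| by rewrite size_sort cardE.
have szB : size sB = #|B| by rewrite size_sort cardE.
have [t [ts tB [i ti]]] :=
  HN (iota 0 N) (fun X => chi [ffun r => inord (nth 0 X (index r sA))])
     (iota_uniq 0 N) (eq_leq (esym (size_iota 0 N))).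
have idx x : index x sB < size t by rewrite tB -szB index_mem.
have t_lt x : nth 0 t (index x sB) < N.+1.
  by have := mem_subseq ts (mem_nth 0 (idx x)); rewrite mem_iota => /andP[_ /ltnW].
pose b : {ffun B -> 'I_N.+1} := [ffun x => inord (nth 0 t (index x sB))].
exists b => [x y xy le_xy|].
  rewrite !ffunE !inordK //; apply: (sorted_ltn_nth ltn_trans) => //; rewrite ?inE //.
    exact: subseq_sorted ltn_trans _ _ ts (iota_ltn_sorted 0 N).
  exact: index_sort_lt.
exists i => g gle; pose X := [seq nth 0 t (index (g r) sB) | r <- sA].
rewrite -(ti X); last by rewrite size_map.
  congr chi; apply/ffunP => r; rewrite !ffunE; congr inord.
  by rewrite (nth_map r) ?index_mem // nth_index.
have -> : X = [seq nth 0 t (index y sB) | y <- map g sA] by rewrite -map_comp.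
suff {2}-> : t = [seq nth 0 t (index y sB) | y <- sB].
  exact/map_subseq/map_sort_subseq.
apply: (eq_from_nth (x0 := 0)) => [|j jt]; first by rewrite size_map szB.
have jB : j < size sB by rewrite szB -tB.
have [x0 _] : exists x0 : B, true by move: jB; case: (sB) => // x0; exists x0.
by rewrite (nth_map x0) // index_uniq // sort_uniq enum_uniq.
Qed.

Lemma exp_embedding_comp (A B C : fin_metric_space) (a : expansion A)
    (b : expansion B) (c : expansion C) (f : A -> B) (g : B -> C) :
  exp_embedding a b f -> exp_embedding b c g -> exp_embedding a c (g \o f).
Proof.
move=> [f1 f2 f3] [g1 g2 g3]; split=> [x y|x y|x] /=.
- exact: etrans (g1 _ _) (f1 _ _).
- by rewrite g2.
- by rewrite g3.
Qed.

Lemma convex_order_parts (T : Type) (le : rel T) (P : pred T) x y :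
  convex_order le P -> P x != P y -> le x y = P x.
Proof.
move=> [[_ _ _ tot] conv]; have := tot x y; have := conv x y; have := conv y x.
by case: (P x); case: (P y); case: (le x y); case: (le y x) => //=; lia.
Qed.

Lemma linear_order_sym (T : Type) (le : rel T) x y :
  linear_order le -> x <> y -> le y x = ~~ le x y.
Proof.
move=> [_ anti _ tot] xy; have := tot x y; have : ~ (le x y && le y x) by move/anti.
by case: (le x y); case: (le y x) => //= /(_ isT).
Qed.

(** * Two-point spaces and triangles with even distances *)

Section Seg.
Variables (n j : nat).
Hypothesis n3 : n <= 3.

(** Even distances keep all points in one part. For distinct indices below 3 the sum is 2 only for
    the pair 02. *)
Definition seg_dist (x y : 'I_n) : nat :=
  if x == y then 0 else if x + y == 2 then 2 else j.+1.*2.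

Lemma seg_dist_eq0 x y : seg_dist x y = 0 <-> x = y.
Proof. by rewrite /seg_dist; case: eqVneq => // xy; case: ifP; split=> // E; case/eqP: xy. Qed.

Lemma seg_dist_sym x y : seg_dist x y = seg_dist y x.
Proof. by rewrite /seg_dist eq_sym addnC. Qed.

Lemma seg_dist_tri x y z : seg_dist x z <= seg_dist x y + seg_dist y z.
Proof.
rewrite /seg_dist -!val_eqE /=.
have := ltn_ord x; have := ltn_ord y; have := ltn_ord z.
by do !case: ifP; lia.
Qed.

(* For [n = 3], the triangle with sides [2j+2, 2j+2, 2] at the pairs
   [01, 12, 02]; for [n = 2], its side [01]. *)
Definition seg : fin_metric_space :=
  FinMetricSpace (Metric seg_dist_eq0 seg_dist_sym seg_dist_tri).

Definition seg_exp (p : bool) : expansion seg :=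
  Expansion (A := seg) (fun x y : 'I_n => x <= y) (fun=> p).

End Seg.

Lemma seg2_embedding (D : fin_metric_space) (d : expansion D) (j : nat) (u v : D) :
  linear_order (ord_le d) -> u <> v -> ord_le d u v -> in_part d u = in_part d v ->
  fin_space_metric D u v = j.+1.*2 ->
  exp_embedding (seg_exp j (isT : 2 <= 3) (in_part d u)) d
    (fun i => if i == ord0 then u else v).
Proof.
move=> lin uv le Puv duv; have [refl _ _ _] := lin.
have I2 (i : 'I_2) : i = ord0 \/ i = ord_max.
  by case: i => -[|[|]] // ?; [left|right]; apply: ord_inj.
split=> [x y|x y|x]; rewrite /distance /=.
- case: (I2 x) => ->; case: (I2 y) => -> /=; rewrite /seg_dist /= ?duv //.
  + exact/dist_eq0.
  + by rewrite dist_sym.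
  + exact/dist_eq0.
- case: (I2 x) => ->; case: (I2 y) => -> /=; rewrite ?refl ?le //.
  by rewrite (linear_order_sym lin uv) le.
- by case: ifP.
Qed.

Lemma agree_pair (T : finType) (le le' : rel T) (x y : T) :
  linear_order le -> linear_order le' ->
  [forall u in [set x; y], forall v in [set x; y], le u v == le' u v]
  = (le x y == le' x y).
Proof.
move=> lin lin'; have [refl _ _ _] := lin; have [refl' _ _ _] := lin'.
apply/forall_inP/eqP => [/(_ x (set21 x y))/forall_inP/(_ y (set22 x y))/eqP //|E u uX].
apply/forall_inP => v vX; apply/eqP; move: uX vX; rewrite !inE.
have [<-|/eqP xy] := eqVneq x y.
  by rewrite !orbb => /eqP-> /eqP->; rewrite refl refl'.
move=> /orP[]/eqP-> /orP[]/eqP->; rewrite ?refl ?refl' //.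
by rewrite (linear_order_sym lin xy) (linear_order_sym lin' xy) E.
Qed.

(** * The bipartite class *)

Section BipartiteClass.
Variables (delta C0 : nat) (HS : metric_space -> Prop).
Hypothesis hdelta : 3 <= delta.
Hypothesis hC0_gt : 2 * delta + 3 < C0.
Hypothesis hC0_even : ~~ odd C0.
Hypothesis hS : admissible delta C0 HS.

Let H := (C0 - 2)./2.
Let HE : H.*2 + 2 = C0. Proof. by rewrite /H; lia. Qed.
Let H_gt : delta < H. Proof. by have := HE; lia. Qed.

Let K := fun A : fin_metric_space => bipartite_class delta C0 A /\ omits HS A.

Lemma class_dist_le (A : fin_metric_space) : bipartite_class delta C0 A ->
  forall x y, fin_space_metric A x y <= delta.
Proof.
move=> [dA _] x y; have [->|xy] := pselect (x = y); first by rewrite dist0.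
by have /andP[] := dA x y xy.
Qed.

Lemma class_perimeter (A : fin_metric_space) : bipartite_class delta C0 A ->
  forall x y z, fin_space_metric A x y + fin_space_metric A y z
                + fin_space_metric A x z <= H.*2.
Proof.
move=> hA x y z; have le := class_dist_le hA; have [_ noT] := hA.
have := le x y; have := le y z; have := le x z; have := H_gt.
have [->|xy] := pselect (x = y); first by rewrite dist0; lia.
have [->|yz] := pselect (y = z); first by rewrite dist0; lia.
have [->|xz] := pselect (x = z); first by rewrite dist0; lia.
have := HE; have := noT x y z xy yz xz; rewrite /forbidden_perimeter /distance /=.
set s := _ + _ + _; move=> nf HE' _ _ _ _; rewrite leqNgt; apply/negP => Hs.
apply: nf; have [os|es] := boolP (odd s); [by left | right; split=> //].
by lia.
Qed.

Lemma ramsey_embeddings (A B : fin_metric_space) (a : expansion A)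
    (b : expansion B) (Col : finType) :
  convex_expansions K a -> convex_expansions K b -> Col ->
  exists (C : fin_metric_space) (c : expansion C), convex_expansions K c /\
  forall col : {set C} -> Col, exists2 f : B -> C, exp_embedding b c f &
  exists i, forall g : A -> B, exp_embedding a b g ->
  col [set f (g x) | x in [set: A]] = i.
Proof.
move=> [[hA omA] parA [linA convA]] [[hB omB] parB [linB convB]] k0.
pose dA : A -> A -> nat := fin_space_metric A.
pose dB : B -> B -> nat := fin_space_metric B.
have [N HN] := ordered_ramsey linA linB k0.
pose G : {set {ffun A -> B}} := [set g : {ffun A -> B} | `[< exp_embedding a b g >]].
have G_emb (g : {ffun A -> B}) : g \in G -> exp_embedding a b g.
  by rewrite inE => /asboolP.
(* The initial system ignores distances: ['I_N] records the order and [bool] the part, and its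
   copies of [B] are all increasing maps that preserve parts. *)
pose T0 : finType := ('I_N * bool)%type.
pose F0 : {set {ffun B -> T0}} :=
  [set h : {ffun B -> T0} | [forall x, forall y, (x != y) && ord_le b x y ==> ((h x).1 < (h y).1)]
           && [forall x, (h x).2 == in_part b x]].
have F0P (h : {ffun B -> T0}) : h \in F0 ->
    (forall x y, x <> y -> ord_le b x y -> (h x).1 < (h y).1)
    /\ forall x, (h x).2 = in_part b x.
  rewrite inE => /andP[/'forall_forallP h1 /'forall_eqP h2]; split=> // x y xy le.
  by have := h1 x y; rewrite le andbT; move/eqP: xy => ->.
have F0_inj h : h \in F0 -> injective h.
  move=> /F0P[h1 _] x y E; apply: contrapT => xy; have [_ _ _ tot] := linB.
  have := h1 y x (nesym xy); have := h1 x y xy; rewrite E ltnn.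
  by case/orP: (tot x y) => le; [move/(_ le) | move=> _ /(_ le)].
have F0R : ramsey_system G Col F0.
  move=> chi.
  have [h hlt [i hi]] := HN (fun al => chi [ffun r => (al r, in_part a r)]).
  exists [ffun x => (h x, in_part b x)].
    rewrite inE; apply/andP; split; last by apply/'forall_eqP => x; rewrite ffunE.
    apply/'forall_forallP => x y; apply/implyP => /andP[/eqP xy le].
    by rewrite !ffunE; apply: hlt.
  exists i => g /G_emb[_ gle gP]; rewrite -(hi g gle); congr chi.
  by apply/ffunP => r; rewrite !ffunE gP.
have G_iso (g : {ffun A -> B}) r s : g \in G -> dB (g r) (g s) = dA r s.
  by move=> /G_emb[gi _ _]; apply: gi.
have G_inj g : g \in G -> injective g.
  move=> /G_iso gi x y E; apply/(dist_eq0 (fin_space_metric A)).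
  by have := gi x y; rewrite E /dA /dB dist0.
(* Goodness up to [H] steps is all that [completion] asks for. *)
have [T [F [q [FF0 FR svF gF cF]]]] := stages (H := H) (dist_sym _)
  (fun r s => leq_trans (class_dist_le hA r s) (ltnW H_gt)) (@dist0 B) (dist_sym _)
  (dist_triangle _) (class_perimeter hB) G_inj G_iso k0 F0_inj F0R H.
pose P : pred T := fun x => (q x).2; pose rho (x : T) : nat := (q x).1.
have qP h x : h \in F -> P (h x) = in_part b x.
  by move=> /FF0/F0P[_ /(_ x)]; rewrite ffunE.
have e_sym x y l : edge dB F x y l -> edge dB F y x l.
  move=> [h [u [v [hF uv -> -> ->]]]]; exists h, v, u; split=> //; first by move/esym.
  exact: dist_sym.
have e_lab x y l : edge dB F x y l -> 0 < l <= delta.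
  by move=> [h [u [v [hF uv _ _ ->]]]]; have [dB1 _] := hB; apply: dB1.
have e_par x y l : edge dB F x y l -> odd l = (P x (+) P y).
  move=> [h [u [v [hF uv -> -> ->]]]]; rewrite !qP //.
  have := parB u v; rewrite /distance /= /dB; case: (odd _) => -[p1 p2].
    by move: p2; case: (in_part b u); case: (in_part b v) => // /(_ erefl).
  by rewrite p1 // addbb.
have e_omit (M : metric_space) : HS M -> ~ exists f : M -> T,
    forall x y, x <> y -> edge dB F (f x) (f y) (distance x y).
  move=> HM [f /cF[f' f'M]]; apply: (omB M HM); exists f' => x y.
  have [->|xy] := pselect (x = y); last exact: f'M.
  by rewrite /distance /= dist0; apply/esym/dist_eq0.
have [m [Km mE]] := completion hdelta hC0_gt hC0_even hS e_sym e_lab e_par gF e_omit rho.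
exists (FinMetricSpace m), (Expansion (A := FinMetricSpace m) (lex_le P rho) P).
split=> // col.
have [h hF [i hi]] := FR (fun al => col [set al x | x in [set: A]]).
exists h; last first.
  exists i => g gemb; rewrite -(hi (finfun g)); last first.
    rewrite inE; apply/asboolP; case: gemb => g1 g2 g3.
    by split=> [x y|x y|x]; rewrite !ffunE; [apply: g1|apply: g2|apply: g3].
  by congr col; apply: eq_imset => x; rewrite !ffunE.
split=> [x y|x y|x]; last exact: qP.
  rewrite /distance /=; have [->|xy] := pselect (x = y).
    by rewrite dist0; apply/dist_eq0.
  by apply: mE; exists h, x, y.
apply: (lex_le_embedding (PB := in_part b)) => //; first by move=> z; apply: qP.
move=> u v uv le _; have /FF0/F0P[/(_ u v uv le) + _] := hF.
by rewrite !ffunE.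
Qed.

Lemma class_ramsey : ramsey (convex_expansions K).
Proof.
move=> A B a b k Ka Kb k1.
have [C [c [Kc Cc]]] := ramsey_embeddings Ka Kb (Ordinal k1).
exists C, c; split=> // col; have [f femb [i fi]] := Cc col.
exists (f @: [set: B]); first by exists f.
exists i => X [g0 [g1 g2 g3] ->] /subsetP sub.
have /fin_all_exists[g gE] x : exists y, g0 x = f y.
  have /imsetP[y _ ->] : g0 x \in f @: [set: B] by apply/sub/imset_f; rewrite inE.
  by exists y.
have [f1 f2 f3] := femb.
rewrite -(fi g).
  by congr col; apply: eq_imset => x; rewrite gE.
split=> [x y|x y|x]; last by rewrite -f3 -gE.
- by apply: etrans (g1 x y); rewrite -(f1 (g x) (g y)) -!gE.
- by rewrite -f2 -!gE.
Qed.

(** The disjoint union, without edges between the two spaces, is completed. A closed walk stays on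
    one side, and so does a clique. *)
Lemma joint_embedding (A B : fin_metric_space) (a : expansion A) (b : expansion B) :
  convex_expansions K a -> convex_expansions K b ->
  exists (C : fin_metric_space) (c : expansion C), [/\ convex_expansions K c,
    exists f : A -> C, exp_embedding a c f & exists f : B -> C, exp_embedding b c f].
Proof.
move=> [[hA omA] parA convA] [[hB omB] parB convB].
pose eD (D : fin_metric_space) (u v : D) l := u <> v /\ l = fin_space_metric D u v.
pose e (x y : A + B) l := match x, y with
  | inl u, inl v => eD A u v l | inr u, inr v => eD B u v l | _, _ => False end.
pose P : pred (A + B)%type :=
  fun x => match x with inl u => in_part a u | inr v => in_part b v end.
pose rho (x : A + B) := match x with
  | inl u => index u (sort (ord_le a) (enum A))
  | inr v => index v (sort (ord_le b) (enum B)) end.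
have eD_lab (D : fin_metric_space) u v l : bipartite_class delta C0 D ->
    eD D u v l -> 0 < l <= delta.
  by move=> [hD _] [uv ->]; apply: hD.
have eD_par (D : fin_metric_space) (d : expansion D) u v l :
    determines_bipartition (in_part d) -> eD D u v l ->
    odd l = (in_part d u (+) in_part d v).
  move=> /(_ u v) + [_ ->]; rewrite /distance /=; case: (odd _) => -[p1 p2].
    by move: p2; case: (in_part d u); case: (in_part d v) => // /(_ erefl).
  by rewrite p1 // addbb.
have e_sym x y l : e x y l -> e y x l.
  by case: x y => [u|u] [v|v] //= [uv ->]; split; rewrite 1?dist_sym //; apply: nesym.
have e_lab x y l : e x y l -> 0 < l <= delta.
  by case: x y => [u|u] [v|v] //=; apply: eD_lab.
have e_par x y l : e x y l -> odd l = (P x (+) P y).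
  by case: x y => [u|u] [v|v] //=; apply: eD_par.
have e_good : good H e H.
  have stay x y n c s : walk H e x y n c s -> match x, y with
      | inl u, inl v => walk H (eD A) u v n c s
      | inr u, inr v => walk H (eD B) u v n c s | _, _ => False end.
    elim=> [[u|u]|u v w l b' m c' t]; [exact: walk_nil|exact: walk_nil|].
    by case: u v w => [u|u] [v|v] [w|w] //= ee _ IH; apply: walk_cons ee IH.
  have goodD (D : fin_metric_space) u n s : bipartite_class delta C0 D ->
      walk H (eD D) u u n true s -> H <= s.
    move=> hD w; have {}w := walk_map (f := id)
      (e' := fun u v l => l = fin_space_metric D u v) (fun _ _ _ e1 => proj2 e1) w.
    have := walk_metric (@dist0 D) (dist_sym _) (dist_triangle _)
      (class_perimeter hD) w.
    by rewrite dist0 subn0.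
  by move=> [u|u] n s _ /stay; apply: goodD.
have e_omit (M : metric_space) : HS M -> ~ exists f : M -> (A + B)%type,
    forall x y, x <> y -> e (f x) (f y) (distance x y).
  move=> HM [f fM]; have [_ [g _] _] := hS HM; pose m0 := g ord0.
  have iso (D : fin_metric_space) (h : M -> D) :
      (forall x y, x <> y -> eD D (h x) (h y) (distance x y)) -> embeds M D.
    move=> hM; exists h => x y; have [->|xy] := pselect (x = y).
      by rewrite /distance /= dist0; apply/esym/dist_eq0.
    by have [_ ->] := hM _ _ xy.
  case fm0 : (f m0) => [u0|u0].
    apply: (omA M HM); apply: (iso A (fun x => if f x is inl u then u else u0)).
    have side x : exists u, f x = inl u.
      have [<-|xm] := pselect (m0 = x); first by exists u0.
      by have := fM _ _ xm; rewrite fm0; case: (f x) => // u _; exists u.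
    move=> x y xy; have := fM _ _ xy.
    by have [u ->] := side x; have [v ->] := side y.
  apply: (omB M HM); apply: (iso B (fun x => if f x is inr u then u else u0)).
  have side x : exists u, f x = inr u.
    have [<-|xm] := pselect (m0 = x); first by exists u0.
    by have := fM _ _ xm; rewrite fm0; case: (f x) => // u _; exists u.
  move=> x y xy; have := fM _ _ xy.
  by have [u ->] := side x; have [v ->] := side y.
have [m [Km mE]] :=
  completion hdelta hC0_gt hC0_even hS e_sym e_lab e_par e_good e_omit rho.
have emb (D : fin_metric_space) (d : expansion D) (f : D -> (A + B)%type) :
    convex_order (ord_le d) (in_part d) ->
    (forall x y, x <> y -> e (f x) (f y) (fin_space_metric D x y)) ->
    (forall x, P (f x) = in_part d x) ->
    (forall x, rho (f x) = index x (sort (ord_le d) (enum D))) ->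
    @exp_embedding D (FinMetricSpace m) d
      (Expansion (A := FinMetricSpace m) (lex_le P rho) P) f.
  move=> convd fe fP frho; split=> // [x y|].
    rewrite /distance /=; have [->|xy] := pselect (x = y).
      by rewrite dist0; apply/dist_eq0.
    exact/mE/fe.
  apply: (lex_le_embedding convd fP) => x y xy le _; rewrite !frho.
  by apply: index_sort_lt => //; case: convd.
exists (FinMetricSpace m), (Expansion (A := FinMetricSpace m) (lex_le P rho) P).
by split=> //; [exists inl | exists inr]; apply: emb.
Qed.

(** Perimeters are at most [2 * delta + 2], and three points cannot hold a constraint. *)
Lemma seg_class (n j : nat) (n3 : n <= 3) p : j < delta./2 ->
  convex_expansions K (seg_exp j n3 p).
Proof.
move=> jd; split; last first.
- split=> //; split; first exact: leqnn.
  + by move=> x y /anti_leq/ord_inj.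
  + by move=> y x z; apply: leq_trans.
  + by move=> x y; apply: leq_total.
- move=> u v; rewrite /distance /= /seg_dist; split=> // _.
  by case: ifP => // _; case: ifP => //; rewrite odd_double.
split; first split.
- move=> x y /eqP xy; rewrite /distance /= /seg_dist (negbTE xy).
  by case: ifP => _; lia.
- move=> x y z /eqP xy /eqP yz /eqP xz.
  rewrite /forbidden_perimeter /distance /= /seg_dist (negbTE xy) (negbTE yz) (negbTE xz).
  move: xy yz xz; rewrite -!val_eqE /=.
  have := ltn_ord x; have := ltn_ord y; have := ltn_ord z.
  by do !case: ifP; lia.
move=> M HM [f fM]; have [_ [g g_inj] _] := hS HM.
suff : injective (f \o g) by move/leq_card; rewrite !card_ord; lia.
move=> x y /= E; apply: g_inj; apply/(dist_eq0 (space_metric M)).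
by rewrite -[LHS]fM E; apply/dist_eq0.
Qed.

(** Members outside the class are skipped, so the family may list all candidate expansions of a
    space. *)
Lemma joint_embeddings (I : eqType) (D : I -> fin_metric_space)
    (d : forall i, expansion (D i)) (s : seq I) :
  exists (C : fin_metric_space) (c : expansion C), convex_expansions K c /\
  forall i, i \in s -> convex_expansions K (d i) ->
  exists f : D i -> C, exp_embedding (d i) c f.
Proof.
elim: s => [|i s [C [c [Kc IH]]]].
  exists (seg 0 (isT : 0 <= 3)), (seg_exp 0 (isT : 0 <= 3) true); split=> //.
  by apply: seg_class; lia.
have [Ki|nKi] := pselect (convex_expansions K (d i)); last first.
  exists C, c; split=> // i'; rewrite inE => /orP[/eqP->|]; [by [] | exact: IH].
have [C' [c' [Kc' fi [f' f'emb]]]] := joint_embedding Ki Kc.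
exists C', c'; split=> // i'; rewrite inE => /orP[/eqP-> //|i's Ki'].
have [f femb] := IH i' i's Ki'.
by exists (f' \o f); apply: exp_embedding_comp f'emb.
Qed.

Lemma ramsey_embeddings_family (I : eqType) (D : I -> fin_metric_space)
    (d : forall i, expansion (D i)) (s : seq I) (Col : finType) (k0 : Col)
    (B : fin_metric_space) (b : expansion B) :
  (forall i, i \in s -> convex_expansions K (d i)) -> convex_expansions K b ->
  exists (C : fin_metric_space) (c : expansion C), convex_expansions K c /\
  forall col : {set C} -> Col, exists2 f : B -> C, exp_embedding b c f &
  forall i, i \in s -> exists k, forall g : D i -> B, exp_embedding (d i) b g ->
  col [set f (g x) | x in [set: D i]] = k.
Proof.
elim: s => [|i s IH] Ks Kb.
  exists B, b; split=> // col; exists id; first by split.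
  by move=> i; rewrite in_nil.
have [|C1 [c1 [Kc1 C1P]]] := IH _ Kb; first by move=> i' i's; apply: Ks; rewrite inE i's orbT.
have Ki : convex_expansions K (d i) by apply: Ks; rewrite mem_head.
have [C [c [Kc CP]]] := ramsey_embeddings Ki Kc1 k0.
exists C, c; split=> // col; have [h hemb [k hk]] := CP col.
have [f femb fP] := C1P (fun X => col (h @: X)).
exists (h \o f); first exact: exp_embedding_comp hemb.
move=> i'; rewrite inE => /orP[/eqP->|i's].
  by exists k => g gemb; apply: (hk (f \o g)); apply: exp_embedding_comp femb.
have [k' k'P] := fP i' i's; exists k' => g gemb; rewrite -(k'P g gemb) -imset_comp.
by congr col.
Qed.

(** * The expansion property *)

Lemma bipartition_shift (C : fin_metric_space) (P P' : pred C) :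
  determines_bipartition P -> determines_bipartition P' ->
  exists eps : bool, forall x, P' x = P x (+) eps.
Proof.
move=> hP hP'; case: (pickP (fun _ : C => true)) => [x0 _|C0']; last first.
  by exists true => x; have := C0' x.
exists (P x0 (+) P' x0) => x.
have : (P x == P x0) = (P' x == P' x0).
  by apply/eqP/eqP => [/(hP x x0)/(hP' x x0)|/(hP' x x0)/(hP x x0)].
by case: (P x); case: (P x0); case: (P' x); case: (P' x0).
Qed.

(* Pulls an expansion back through a swap of the parts when [eps] holds and a
   reversal of the order inside each part [p] with [sg p = false]. *)
Definition twist (A : fin_metric_space) (a : expansion A) (eps : bool)
    (sg : bool -> bool) : expansion A :=
  let P x := in_part a x (+) eps in
  Expansion (fun x y => if P x != P y then P x
                        else if sg (P x) then ord_le a x y else ord_le a y x) P.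

Lemma twist_class (A : fin_metric_space) (a : expansion A) eps sg :
  convex_expansions K a -> convex_expansions K (twist a eps sg).
Proof.
move=> [KA par [[refl anti trans tot] conv]]; split=> //=.
  move=> u v; rewrite (par u v); split=> [->//|].
  by case: (in_part a u); case: (in_part a v); case: eps.
split; last by move=> u v; case: eqVneq => [->|] //=.
split.
- by move=> x; rewrite eqxx /= refl if_same.
- move=> x y; case: eqVneq => [E|]; last by case: (_ (+) _); case: (_ (+) _).
  rewrite E /=; case: (sg _) => [/anti //|]; by rewrite andbC => /anti.
- move=> y x z; have [->|nxy] := eqVneq (in_part a x (+) eps) (in_part a y (+) eps).
    have [->|nyz] := eqVneq (in_part a y (+) eps) (in_part a z (+) eps) => //=.
    case: (sg _) => le1 le2; [exact: trans le1 le2 | exact: trans le2 le1].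
  have [<-|nyz] := eqVneq (in_part a y (+) eps) (in_part a z (+) eps).
    by rewrite nxy.
  move: nxy nyz; case: (in_part a x); case: (in_part a y); case: (in_part a z);
    by case: (eps).
- move=> x y; rewrite (eq_sym (in_part a y (+) eps)).
  have [->|] := eqVneq (in_part a x (+) eps) (in_part a y (+) eps) => /=.
    by case: (sg _); rewrite ?tot // orbC tot.
  by case: (in_part a x); case: (in_part a y); case: (eps).
Qed.

Lemma class_expansion_property : expansion_property K (convex_expansions K).
Proof.
move=> A KA.
(* Expansions encoded by finite functions can be enumerated, so that [D1] contains every convex
   expansion of [A]. *)
pose ffexp (i : {ffun A * A -> bool} * {ffun A -> bool}) : expansion A :=
  Expansion (fun x y => i.1 (x, y)) (fun x => i.2 x).
have [D1 [d1 [Kd1 D1P]]] := joint_embeddings ffexp (enum {: {ffun A * A -> bool} * {ffun A -> bool}}).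
pose idx := [seq (j, p) | j <- iota 0 delta./2, p <- [:: true; false]].
have idxP j p : j < delta./2 -> (j, p) \in idx.
  move=> jd; apply/allpairsP; exists (j, p); split=> //=; last by case: p.
  by rewrite mem_iota.
have segK n (n3 : n <= 3) i : i \in idx -> convex_expansions K (seg_exp i.1 n3 i.2).
  by move=> /allpairsP[[j p] [/= jd _ ->]]; apply: seg_class; move: jd; rewrite mem_iota.
have [D2 [d2 [Kd2 D2P]]] := joint_embeddings
  (fun i : nat * bool => seg_exp i.1 (isT : 3 <= 3) i.2) idx.
have [D [d [Kd [f1 f1emb] [f2 f2emb]]]] := joint_embedding Kd1 Kd2.
have [C [c [Kc CP]]] := ramsey_embeddings_family
  (d := fun i : nat * bool => seg_exp i.1 (isT : 2 <= 3) i.2) true (segK _ _) Kd.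
exists C; first by case: Kc.
move=> a c' Ka Kc'.
have [[hD _] parD convD] := Kd; have [linD _] := convD.
have [_ parC [linC _]] := Kc; have [_ parC' convC'] := Kc'; have [linC' _] := convC'.
(* The colour of a pair tells whether the orders of [c] and [c'] agree on it; on the copy of [D]
   found it depends only on distance and part. *)
have [f femb fP] := CP (fun X =>
  [forall u in X, forall v in X, ord_le c u v == ord_le c' u v]).
have [fd fle fp] := femb.
have f_inj u v : u <> v -> f u <> f v.
  move=> uv E; apply: uv; apply/(dist_eq0 (fin_space_metric D)).
  by rewrite -[LHS]fd E; apply/dist_eq0.
have [k kP] : exists k : nat * bool -> bool, forall j u v, j < delta./2 -> u <> v ->
    in_part d u = in_part d v -> fin_space_metric D u v = j.+1.*2 ->
    ord_le c' (f u) (f v) = (ord_le d u v == k (j, in_part d u)).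
  have /choice[k kP] (i : nat * bool) : exists b : bool, i \in idx ->
      forall g : seg i.1 (isT : 2 <= 3) -> D,
      exp_embedding (seg_exp i.1 (isT : 2 <= 3) i.2) d g ->
      [forall u in [set f (g x) | x in [set: seg i.1 (isT : 2 <= 3)]],
       forall v in [set f (g x) | x in [set: seg i.1 (isT : 2 <= 3)]],
         ord_le c u v == ord_le c' u v] = b.
    by have [/fP[b bP]|_] := boolP (i \in idx); [exists b | exists true].
  exists k.
  have main j u v : j < delta./2 -> u <> v -> ord_le d u v ->
      in_part d u = in_part d v -> fin_space_metric D u v = j.+1.*2 ->
      ord_le c' (f u) (f v) = k (j, in_part d u).
    move=> jd uv le Puv duv.
    have := kP _ (idxP j (in_part d u) jd) _ (seg2_embedding linD uv le Puv duv).
    have -> : [set f (if x == ord0 then u else v) | x in [set: seg j (isT : 2 <= 3)]]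
              = [set f u; f v].
      apply/setP => z; rewrite !inE; apply/imsetP/orP => [[x _ ->]|].
        by case: ifP => _; [left|right].
      by case=> /eqP->; [exists ord0 | exists ord_max].
    by rewrite agree_pair // fle le => <-; case: (ord_le c' _ _).
  move=> j u v jd uv Puv duv; have := linear_order_sym linD uv.
  case le: (ord_le d u v) => /= le'; first by rewrite (main j).
  rewrite (linear_order_sym linC' (f_inj _ _ (nesym uv))) (main j) //.
  - by rewrite Puv; case: (k _).
  - exact: nesym.
  - by rewrite dist_sym.
have d2_gt0 : 0 < delta./2 by lia.
(* In a triangle the sides 01 and 12 of length [j.+1.*2] chain to the side 02 of length 2, so
   transitivity of the second order forces the same choice for both lengths. *)
have kE j p : j < delta./2 -> k (j, p) = k (0, p).
  move=> jd; have [t temb] := D2P _ (idxP j p jd) (segK _ _ _ (idxP j p jd)).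
  have [td tle tp] := exp_embedding_comp temb f2emb.
  set t' := f2 \o t in td tle tp.
  pose i n : 'I_3 := inord n.
  have [n01 n12 n02] : [/\ t' (i 0) <> t' (i 1), t' (i 1) <> t' (i 2) & t' (i 0) <> t' (i 2)].
    have neq m n : i m != i n -> t' (i m) <> t' (i n).
      move=> mn E; case/eqP: mn; apply/(dist_eq0 (fin_space_metric (seg j (isT : 3 <= 3)))).
      by rewrite -[LHS]td E; apply/dist_eq0.
    by split; apply: neq; rewrite -val_eqE /= !inordK.
  have le m n : m < 3 -> n < 3 -> ord_le d (t' (i m)) (t' (i n)) = (m <= n).
    by move=> m3 n3; rewrite tle /= !inordK.
  have tpE n n' : in_part d (t' (i n)) = in_part d (t' (i n')) by rewrite !tp.
  have dE m n l : m < 3 -> n < 3 -> m != n -> l = (if m + n == 2 then 2 else j.+1.*2) ->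
      fin_space_metric D (t' (i m)) (t' (i n)) = l.
    move=> m3 n3 mn ->; rewrite [LHS]td /distance /= /seg_dist -val_eqE /= !inordK //.
    by rewrite (negbTE mn).
  have := kP j _ _ jd n01 (tpE _ _) (dE 0 1 _ isT isT isT erefl).
  have := kP j _ _ jd n12 (tpE _ _) (dE 1 2 _ isT isT isT erefl).
  have := kP 0 _ _ d2_gt0 n02 (tpE _ _) (dE 0 2 _ isT isT isT erefl).
  rewrite !le // !tp /=; have [_ antiC' transC' _] := linC'.
  have := linear_order_sym linC' (f_inj _ _ n01).
  have := linear_order_sym linC' (f_inj _ _ n12).
  have := linear_order_sym linC' (f_inj _ _ n02).
  have := transC' (f (t' (i 1))) (f (t' (i 0))) (f (t' (i 2))).
  have := transC' (f (t' (i 1))) (f (t' (i 2))) (f (t' (i 0))).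
  case: (k (j, p)); case: (k (0, p)) => //= tr1 tr2 s02 s12 s01 e02 e12 e01.
    by move: tr2; rewrite e01 e12 e02 => /(_ isT isT).
  by move: tr1; rewrite s01 s12 s02 e01 e12 e02 => /(_ isT isT).
have kP' u v : u <> v -> in_part d u = in_part d v ->
    ord_le c' (f u) (f v) = (ord_le d u v == k (0, in_part d u)).
  move=> uv Puv; have [/(_ u v uv) duv _] := hD; rewrite /distance /= in duv.
  have ev : ~~ odd (fin_space_metric D u v) by apply/(parD u v).
  rewrite (kP (fin_space_metric D u v)./2.-1 u v) ?kE //; lia.
have [eps epsP] := bipartition_shift parC parC'.
(* On the image of [D], [c'] differs from [d] by a swap of parts [eps] and reversals given by [sg].
   Embedding the copy of [A] twisted in the same way makes the two changes cancel. *)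
pose sg p := k (0, p).
pose a0 := twist a eps sg.
pose i0 : {ffun A * A -> bool} * {ffun A -> bool} :=
  ([ffun xy => ord_le a0 xy.1 xy.2], [ffun x => in_part a0 x]).
have Ka0 : convex_expansions K (ffexp i0).
  have := twist_class eps sg Ka; rewrite -/a0 /ffexp /i0.
  move=> [KA0 par0 [[r0 an0 t0 tot0] conv0]]; split=> //=.
    by move=> u v; rewrite !ffunE; apply: par0.
  split; last by move=> u v; rewrite !ffunE; apply: conv0.
  split.
  - by move=> x; rewrite ffunE; apply: r0.
  - by move=> x y; rewrite !ffunE; apply: an0.
  - by move=> y x z; rewrite !ffunE; apply: t0.
  - by move=> x y; rewrite !ffunE; apply: tot0.
have [h hemb] := D1P i0 (mem_enum _ _) Ka0.
have [hd hle hp] := exp_embedding_comp hemb f1emb.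
set h' := f1 \o h in hd hle hp.
have hpE x : in_part d (h' x) = in_part a x (+) eps by rewrite hp /= ffunE.
have c'p x : in_part c' (f (h' x)) = in_part a x.
  by rewrite epsP fp hpE -addbA addbb addbF.
have [_ _ conva] := Ka; have [lina _] := conva.
exists (f \o h'); split=> [x y|x y|x] /=; last exact: c'p.
  exact: etrans (fd _ _) (hd _ _).
have [reflC' _ _ _] := linC'; have [refla _ _ _] := lina.
have [->|/eqP xy] := eqVneq x y; first by rewrite reflC' refla.
have h'xy : h' x <> h' y.
  move=> E; apply: xy; apply/(dist_eq0 (fin_space_metric A)).
  by rewrite -[LHS]hd E; apply/dist_eq0.
(* Between different parts, convexity alone determines both orders. *)
have [Pxy|Pxy] := eqVneq (in_part a x) (in_part a y); last first.
  rewrite (convex_order_parts conva Pxy) (convex_order_parts convC') ?c'p //.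
rewrite kP' ?hpE ?Pxy // hle /= ffunE /= Pxy eqxx /= -/(sg _).
have := linear_order_sym lina xy.
by case: (sg _); case: (ord_le a x y) => //= ->.
Qed.

End BipartiteClass.

Theorem theorem6p15 (delta C0 : nat) (HS : metric_space -> Prop)
    (hdelta : 3 <= delta)
    (hC0_gt : 2 * delta + 3 < C0)
    (hC0_even : ~~ odd C0)
    (hC0_le : C0 <= 3 * delta + 2)
    (hS : admissible delta C0 HS) :
  let K := fun A : fin_metric_space => bipartite_class delta C0 A /\ omits HS A in
  ramsey (convex_expansions K) /\ expansion_property K (convex_expansions K).
Proof.
split; first exact: class_ramsey.
exact: class_expansion_property.
Qed.
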